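(* The constant $c_3$ satisfies $c_3>0.07480$.
   Context: For a positive integer $d$, $c_d$ is the supremum of all real numbers $c$ such that for every finite set $P$ of points in $\mathbb{R}^d$ in general position, there is a point of $\mathbb{R}^d$ contained in at least \[c\cdot\binom{|P|}{d+1}-O(|P|^d)\] $d$-dimensional simplices spanned by the points of $P$ (i.e. simplices with vertices in $P$), where the implicit constant in the $O$-term does not depend on $P$. *)

(* Defs.v *)
From mathcomp Require Import all_boot all_order all_algebra finmap.
From mathcomp Require Import boolp classical_sets reals.

Set Implicit Arguments.
Unset Strict Implicit.
Unset Printing Implicit Defensive.

Import Order.TTheory GRing.Theory Num.Theory.

Local Open Scope classical_set_scope.
Local Open Scope fset_scope.
Local Open Scope ring_scope.

(* The hyperplane is { x | <x, u> = b } with normal vector u. *)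
Definition in_common_hyperplane (R : realType) (d : nat)
    (S : {fset 'rV[R]_d}) : Prop :=
  exists u : 'cV[R]_d, exists b : R,
    u != 0 /\ (forall p, p \in S -> (p *m u) ord0 ord0 = b).

Definition general_position (R : realType) (d : nat)
    (P : {fset 'rV[R]_d}) : Prop :=
  forall S : {fset 'rV[R]_d},
    S `<=` P -> #|` S| = d.+1 -> ~ in_common_hyperplane S.

Definition convex_hull (R : realType) (d : nat)
    (S : {fset 'rV[R]_d}) : set 'rV[R]_d :=
  [set x | exists w : 'rV[R]_d -> R,
    [/\ forall p, p \in S -> 0 <= w p,
        \sum_(p <- S) w p = 1
      & x = \sum_(p <- S) w p *: p]].

(* Simplices are closed, and each one is identified with its set of d + 1
   vertices; when P is in general position these vertices are affinely
   independent, so that the simplex is d-dimensional. *)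
Definition simplices_containing (R : realType) (d : nat)
    (P : {fset 'rV[R]_d}) (x : 'rV[R]_d) : {fset {fset 'rV[R]_d}} :=
  [fset S in fpowerset P | (#|` S| == d.+1) && `[< convex_hull S x >]].

(* K is the implicit constant of the O-term: it may depend on d and c, but not
   on P. *)
Definition selection_ratio (R : realType) (d : nat) (c : R) : Prop :=
  exists K : R, forall P : {fset 'rV[R]_d}, general_position P ->
    exists x : 'rV[R]_d,
      c * 'C(#|` P|, d.+1)%:R - K * #|` P|%:R ^+ d
        <= #|` simplices_containing P x|%:R.

(* For 0 < d this set is nonempty and bounded above by 1, so that sup is the
   genuine supremum. *)
Definition selection_constant (R : realType) (d : nat) : R :=
  sup [set c : R | selection_ratio d c].

(* Main.v *)
(** The proof is Gromov's method with a flag-algebra estimate.  Suppose that every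
    point of R^3 lies in at most (3/40) C(n,4) of the simplices spanned by P.  In a
    fine Kuhn triangulation of a large box, in generic position with respect to P,
    let [cut_i t] be the set of (3-i)-simplices spanned by P which meet the
    i-simplex t.  As mod 2 cochains on the full simplex on P they satisfy
    delta (cut_i t) = cut_(i-1) (boundary of t), and for i > 0 they have density
    O(1/n), because by compactness the simplices meeting a small t have a common
    point.  Choose G with delta G_x = cut_0 x, then H with
    delta H_xy = G_x + G_y + cut_1 xy, then K with
    delta K_xyz = H_xy + H_xz + H_yz + cut_2 xyz, each of them small.  Filling a
    cochain by the link of its best vertex costs nothing, so G has density at most
    3/40 and delta H at most 3/20 + o(1); a graph which is minimal in its switching
    class and has density at least .1249 has at least .1505 n^3 odd (ordered)
    triples, so H has density below .1249; hence 2|K|(n - |K|) < (3/8) n^2 and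
    |K| < n/4.  The cochain K_yzw + K_xzw + K_xyw + K_xyz + cut_3 xyzw is
    a cocycle, i.e. constant on P, and by these bounds it does not contain all of
    P, so it is empty.  Summing over the triangulation, the K cancel in pairs (they
    are empty near the boundary of the box), whereas each point of P lies in
    exactly one tetrahedron: a contradiction. *)

From Stdlib Require Import ZArith.
Require Import Defs.
From mathcomp Require Import all_boot all_order all_algebra finmap.
From mathcomp Require Import ssrAC boolp classical_sets functions reals.
From mathcomp Require Import topology function_spaces normedtype.
From mathcomp Require Import interval_inference zify ssrZ ring lra.

Set Implicit Arguments.
Unset Strict Implicit.
Unset Printing Implicit Defensive.

Import Order.TTheory GRing.Theory Num.Theory.
Import numFieldNormedType.Exports.

Local Open Scope ring_scope.
Delimit Scope Z_scope with coqZ.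

(** * Switching-minimal graphs and odd triples *)

Section FlagCertificate.
Local Open Scope Z_scope.

Definition b2z (b : bool) : Z := if b then 1 else 0.

(** Coefficients of one square in the certificate: the flag is a root with two more vertices, and
    [c] is the adjacency between these two. *)
Definition rooted_flag (a b c : bool) : Z :=
  match a, b, c with
  | false, false, false => 1
  | false, false, true => -5
  | true, true, false => 24
  | true, true, true => -1
  | _, _, false => -12
  | _, _, true => -3
  end.

(** [flag1] to [flag4] weigh a vertex by its adjacencies to the roots 0, 1, 2. They respect the
    exchange of 1 and 2, a symmetry of the root triple with single edge 12. *)
Definition flag1 (a b c : bool) : Z :=
  match a, b, c with
  | false, false, false => -9
  | false, true, true => 10
  | false, _, _ => 6
  | true, false, false => -23
  | true, true, true => 24
  | true, _, _ => 2
  end.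

Definition flag2 (a b c : bool) : Z :=
  match a, b, c with
  | false, false, false => 24
  | false, _, _ => -15
  | true, false, false => -1
  | true, true, true => 0
  | true, _, _ => -5
  end.

Definition flag3 (a b c : bool) : Z :=
  match a, b, c with
  | false, true, true => 6
  | true, false, false => 1
  | _, _, _ => 0
  end.

Definition flag4 (a b c : bool) : Z := b2z [&& a, ~~ b & ~~ c].

(* A certificate found by semidefinite programming.  The variable b_ij tells
   whether ij is an edge of a graph on five vertices; and
   [psi] = 72000 ([012 is odd] - .1505) minus terms whose sum over all 5-tuples
   of vertices is nonnegative: with 012 an empty triple, the excess of the edge
   density over 11420/91440 < .1249 and the cut condition for the common
   neighbourhoods of 0,1,2 and of 1,2; squares of sums of flags rooted at 0 and at
   the triple 012 with the single edge 12.  On the other hand [psi] is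
   nonnegative after averaging over the relabelings of every 5-vertex graph. *)
Definition psi (b01 b02 b03 b04 b12 b13 b14 b23 b24 b34 : bool) : Z :=
  (72000 * b2z (b01 (+) b12 (+) b02) - 10836
   - b2z [&& ~~ b01, ~~ b02 & ~~ b12] * (91440 * b2z b34 - 11420)
   - b2z [&& ~~ b01, ~~ b02 & ~~ b12] *
     ((261000 * b2z [&& b03, b13 & b23] * b2z (~~ [&& b04, b14 & b24])
       + 225000 * b2z (b13 && b23) * b2z (~~ (b14 && b24))) *
      (1 - 2 * b2z b34))
   - 480 * (rooted_flag b01 b02 b12 * rooted_flag b03 b04 b34)
   - b2z [&& ~~ b01, ~~ b02 & b12] *
      (200 * (flag1 b03 b13 b23 * flag1 b04 b14 b24)
       + 175 * (flag2 b03 b13 b23 * flag2 b04 b14 b24)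
       + 1200 * (flag3 b03 b13 b23 * flag3 b04 b14 b24)
       + 36000 * (flag4 b03 b13 b23 * flag4 b04 b14 b24))).

Definition psi_at (g : nat -> nat -> bool) (s : seq nat) : Z :=
  if s is [:: i0; i1; i2; i3; i4] then
    psi (g i0 i1) (g i0 i2) (g i0 i3) (g i0 i4) (g i1 i2) (g i1 i3)
      (g i1 i4) (g i2 i3) (g i2 i4) (g i3 i4)
  else 0.

(** Position 10 is past the end of the ten bits, so a loop reads as a non-edge. *)
Definition graph_of_bits (bs : seq bool) (i j : nat) : bool :=
  let e k l : bool := nth false bs (match k, l with
    | 0, 1 => 0 | 0, 2 => 1 | 0, 3 => 2 | 0, 4 => 3
    | 1, 2 => 4 | 1, 3 => 5 | 1, 4 => 6
    | 2, 3 => 7 | 2, 4 => 8 | 3, 4 => 9 | _, _ => 10 end)%N in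
  if (i < j)%N then e i j else e j i.

Fixpoint all_bits (n : nat) (P : seq bool -> bool) : bool :=
  if n is m.+1 then
    all_bits m (fun s => P (true :: s)) && all_bits m (fun s => P (false :: s))
  else P [::].

Definition perms5 : seq (seq nat) := permutations (iota 0 5).

Definition psi_sum (g : nat -> nat -> bool) : Z :=
  foldr (fun s z => Z.add (psi_at g s) z) 0 perms5.

Lemma psi_sum_check :
  all_bits 10 (fun bs => Z.leb 0 (psi_sum (graph_of_bits bs))).
Proof. by vm_compute. Qed.

End FlagCertificate.

(** * Sums over 5-tuples of vertices and their relabelings *)

Definition sum5 (V : finType) (f : V -> V -> V -> V -> V -> Z) : Z :=
  \sum_a \sum_b \sum_c \sum_d \sum_e f a b c d e.

Section Sum5.
Variable V : finType.
Implicit Types f g : V -> V -> V -> V -> V -> Z.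

Lemma sum5D f g :
  sum5 (fun a b c d e => f a b c d e + g a b c d e) = sum5 f + sum5 g.
Proof. by rewrite /sum5; do 4 (rewrite -big_split; apply: eq_bigr => ? _) ; rewrite -big_split. Qed.

Lemma sum5N f : sum5 (fun a b c d e => - f a b c d e) = - sum5 f.
Proof. by rewrite /sum5; do 4 (rewrite -sumrN; apply: eq_bigr => ? _) ; rewrite -sumrN. Qed.

Lemma sum5_ge0 f :
  (forall a b c, 0 <= \sum_d \sum_e f a b c d e) -> 0 <= sum5 f.
Proof. by move=> h; do 3 (apply: sumr_ge0 => ? _). Qed.

Lemma sum5_mulr (h : V -> V -> V -> Z) :
  sum5 (fun a b c _ _ => h a b c) =
  #|V|%:R ^+ 2 * \sum_a \sum_b \sum_c h a b c.
Proof.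
rewrite /sum5; do 3 (rewrite big_distrr; apply: eq_bigr => ? _ /=).
by rewrite !sumr_const -mulrnA -[LHS]mulr_natl natrM expr2.
Qed.

Lemma sum2_mul (f g : V -> Z) :
  \sum_d \sum_e f d * g e = (\sum_d f d) * \sum_e g e.
Proof. by rewrite big_distrlr. Qed.

Definition tup5 (a b c d e : V) (i : nat) : V := nth e [:: a; b; c; d; e] i.

(** Written as one sum over functions on five positions, the nested sum can be reindexed by a
    permutation of the positions. *)
Lemma sum5_ffun (f : (nat -> V) -> Z) :
  (forall u u', (forall i, (i < 5)%N -> u i = u' i) -> f u = f u') ->
  sum5 (fun a b c d e => f (tup5 a b c d e)) =
  \sum_(v : {ffun 'I_5 -> V}) f (fun i => v (inord i)).
Proof.
move=> fE; rewrite /sum5 !pair_bigA /=.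
pose h (p : V * V * V * V * V) : {ffun 'I_5 -> V} :=
  [ffun i : 'I_5 => tup5 p.1.1.1.1 p.1.1.1.2 p.1.1.2 p.1.2 p.2 i].
rewrite (reindex h) /=; last first.
  apply: onW_bij.
  exists (fun v : {ffun 'I_5 -> V} => (v (inord 0), v (inord 1), v (inord 2), v (inord 3),
      v (inord 4))).
    by move=> [[[[a b] c] d] e]; rewrite /h !ffunE !inordK.
  move=> v; apply/ffunP => i; rewrite ffunE /=.
  by rewrite -[in RHS](inord_val i); case: i => -[|[|[|[|[|//]]]]] /=.
by apply: eq_bigr => p _; apply: fE => i i5; rewrite ffunE inordK.
Qed.

Lemma sum5_perm (f : (nat -> V) -> Z) (s : seq nat) :
  (forall u u', (forall i, (i < 5)%N -> u i = u' i) -> f u = f u') ->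
  perm_eq s (iota 0 5) ->
  sum5 (fun a b c d e => f (fun i => tup5 a b c d e (nth 0%N s i))) =
  sum5 (fun a b c d e => f (tup5 a b c d e)).
Proof.
move=> fE ps.
have sz : size s = 5%N by rewrite (perm_size ps) size_iota.
have s5 i : (i < 5)%N -> (nth 0%N s i < 5)%N.
  move=> i5; have : nth 0%N s i \in iota 0 5 by rewrite -(perm_mem ps) mem_nth ?sz.
  by rewrite mem_iota.
rewrite (sum5_ffun (f := fun u => f (fun i => u (nth 0%N s i)))); last first.
  by move=> u u' uu'; apply: fE => i i5; apply: uu'; apply: s5.
rewrite sum5_ffun //.
(* Composition with [s] is injective because every position below 5 occurs in [s]. *)
pose h (v : {ffun 'I_5 -> V}) : {ffun 'I_5 -> V} :=
  [ffun i : 'I_5 => v (inord (nth 0%N s i))].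
rewrite [RHS](reindex_inj (h := h)) /=; last first.
  move=> v v' /ffunP hv; apply/ffunP => k.
  have ks : (k : nat) \in s by rewrite (perm_mem ps) mem_iota /=.
  have i5 : (index (k : nat) s < 5)%N by rewrite -[X in (_ < X)%N]sz index_mem.
  by have := hv (Ordinal i5); rewrite !ffunE /= nth_index // inord_val.
by apply: eq_bigr => v _; apply: fE => i i5; rewrite ffunE inordK.
Qed.

End Sum5.

Lemma all_bitsP n (P : seq bool -> bool) :
  all_bits n P -> forall s, size s = n -> P s.
Proof.
elim: n P => [|n IH] P /=; first by move=> h s /size0nil ->.
by move=> /andP[h1 h2] [|[] s] //= [sz]; [apply: (IH _ h1)|apply: (IH _ h2)].
Qed.

(** Only off-diagonal values are read, so [g] may be replaced by a graph encoded by ten bits,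
    whatever [g] does on the diagonal. This matters because a 5-tuple may repeat a vertex. *)
Lemma psi_sum_ge0 (g : nat -> nat -> bool) :
  (forall i j, g i j = g j i) -> 0 <= psi_sum g.
Proof.
move=> gC.
pose bs := [:: g 0 1; g 0 2; g 0 3; g 0 4; g 1 2; g 1 3; g 1 4; g 2 3; g 2 4; g 3 4]%N.
have gE i j : (i < 5)%N -> (j < 5)%N -> i != j -> g i j = graph_of_bits bs i j.
  by case: i => [|[|[|[|[|i]]]]]; case: j => [|[|[|[|[|j]]]]] //= _ _ _; rewrite gC.
have -> : psi_sum g = psi_sum (graph_of_bits bs).
  rewrite /psi_sum.
  have : all (fun s => perm_eq s (iota 0 5)) perms5.
    by apply/allP => s; rewrite mem_permutations.
  elim: perms5 => //= s l IH /andP[ps /IH ->]; congr (Z.add _ _).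
  have sz := perm_size ps.
  case: s ps sz => [|i0 [|i1 [|i2 [|i3 [|i4 [|]]]]]] // ps _.
  have us : uniq [:: i0; i1; i2; i3; i4] by rewrite (perm_uniq ps).
  have lt5 i : i \in [:: i0; i1; i2; i3; i4] -> (i < 5)%N.
    by rewrite (perm_mem ps) -[X in _ \in X]/(iota 0 5) mem_iota.
  move: us; rewrite /= !inE !negb_or => /and5P[/and4P[? ? ? ?] /and3P[? ? ?]].
  move=> /andP[? ?] ? _.
  by congr psi; apply: gE => //; apply: lt5; rewrite !inE eqxx ?orbT.
have /all_bitsP/(_ bs erefl) := psi_sum_check.
by move=> /Z.leb_le h; lia.
Qed.

(** * Consequences of switching minimality *)

Definition cnt1 (V : finType) (f : V -> bool) : nat := (\sum_a f a)%N.
Definition cnt2 (V : finType) (f : V -> V -> bool) : nat :=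
  (\sum_a \sum_b f a b)%N.
Definition cnt3 (V : finType) (f : V -> V -> V -> bool) : nat :=
  (\sum_a \sum_b \sum_c f a b c)%N.
Definition cnt4 (V : finType) (f : V -> V -> V -> V -> bool) : nat :=
  (\sum_a \sum_b \sum_c \sum_d f a b c d)%N.

Lemma b2zE (b : bool) : b2z b = b%:R. Proof. by case: b. Qed.

Section Seidel.
Variables (V : finType) (W : V -> V -> bool).
Hypothesis Wsym : forall x y, W x y = W y x.
Hypothesis Wmin : forall U : V -> bool,
  (cnt2 W <= cnt2 (fun x y => W x y (+) (U x (+) U y)))%N.

(** Switching by [U] exchanges edges and non-edges across the cut and leaves all other pairs alone;
    by minimality at most half of the pairs across are edges. *)
Lemma cut_ge0 (U U' : V -> bool) : (forall x, U' x = ~~ U x) ->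
  0 <= \sum_x \sum_y b2z (U x) * b2z (U' y) * (1 - 2%:R * b2z (W x y)).
Proof.
move=> UE.
pose T x y := b2z (U x) * b2z (U' y) * (1 - 2%:R * b2z (W x y)).
have TT : \sum_x \sum_y T x y = \sum_x \sum_y T y x by rewrite exchange_big.
have : ((cnt2 W)%:R : Z) <= (cnt2 (fun x y => W x y (+) (U x (+) U y)))%:R.
  by rewrite ler_nat Wmin.
rewrite -subr_ge0 /cnt2 !natr_sum -sumrB.
have -> : \sum_i ((\sum_b (W i b (+) (U i (+) U b) : nat))%N%:R - (\sum_b (W i b : nat))%N%:R)%R
   = \sum_x \sum_y T x y + \sum_x \sum_y T y x.
  rewrite -big_split; apply: eq_bigr => x _; rewrite !natr_sum -sumrB -big_split.
  apply: eq_bigr => y _; rewrite /T (Wsym y x) !UE.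
  by case: (W x y) (U x) (U y) => [] [] [].
rewrite -TT -mulr2n => h.
by move: h; rewrite pmulrn_lge0.
Qed.

Let g5 (u : nat -> V) (i j : nat) : bool := W (u i) (u j).

(** The sum over all 5-tuples is invariant under relabeling, so 120 times this sum is a sum of
    values of [psi_sum]. *)
Lemma sum5_psi_ge0 :
  0 <= sum5 (fun a b c d e => psi (W a b) (W a c) (W a d) (W a e)
         (W b c) (W b d) (W b e) (W c d) (W c e) (W d e)).
Proof.
set f5 := (X in sum5 X).
pose f (u : nat -> V) : Z := psi_at (g5 u) (iota 0 5).
have fE u u' : (forall i, (i < 5)%N -> u i = u' i) -> f u = f u'.
  by move=> uu'; rewrite /f /= /g5 !uu'.
have sum_perms (l : seq (seq nat)) : all (fun s => perm_eq s (iota 0 5)) l ->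
    sum5 (fun a b c d e =>
      foldr (fun s z => Z.add (psi_at (g5 (tup5 a b c d e)) s) z) 0%coqZ l) =
    sum5 f5 *+ size l.
  elim: l => [_|s l IH /= /andP[ps /IH IHl]].
    by rewrite mulr0n; do 5 (apply: big1 => ? _).
  rewrite [LHS](sum5D (fun a b c d e => psi_at (g5 (tup5 a b c d e)) s)) IHl mulrS.
  congr (_ + _).
  rewrite -[RHS](sum5_perm fE ps); congr sum5.
  have := perm_size ps.
  by case: s ps => [|i0 [|i1 [|i2 [|i3 [|i4 [|]]]]]].
have allp : all (fun s => perm_eq s (iota 0 5)) perms5.
  by apply/allP => s; rewrite mem_permutations.
have := sum_perms _ allp.
have -> : size perms5 = 120%N by vm_compute.
move=> E; have : 0 <= sum5 f5 *+ 120.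
  rewrite -E; do 5 (apply: sumr_ge0 => ? _).
  by apply: psi_sum_ge0 => i j; rewrite /g5 Wsym.
by rewrite pmulrn_lge0.
Qed.


(* Gromov's second cofilling profile, in the weak form phi_2(.1249) >= .1505 *)
Lemma odd_triples_lower_bound :
  1249%coqZ * #|V|%:R ^+ 2 <= 10000%coqZ * (cnt2 W)%:R ->
  301%coqZ * #|V|%:R ^+ 3 <=
    2000%coqZ * (cnt3 (fun x y z => W x y (+) W y z (+) W x z))%:R.
Proof.
move=> dens.
have := sum5_psi_ge0.
pose n : Z := #|V|%:R.
pose E a b c := b2z [&& ~~ W a b, ~~ W a c & ~~ W b c].
pose P1 (a b c d e : V) := 72000%coqZ * b2z (W a b (+) W b c (+) W a c).
pose P2 (a b c d e : V) := 10836%coqZ.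
pose P3 (a b c d e : V) := E a b c * (91440%coqZ * b2z (W d e) - 11420%coqZ).
pose P4 (a b c d e : V) := E a b c *
     ((261000%coqZ * b2z [&& W a d, W b d & W c d] * b2z (~~ [&& W a e, W b e & W c e])
       + 225000%coqZ * b2z (W b d && W c d) * b2z (~~ (W b e && W c e))) *
      (1 - 2%:R * b2z (W d e))).
pose r a b c := rooted_flag (W a b) (W a c) (W b c).
pose P5 (a b c d e : V) := 480%coqZ * (r a b c * r a d e).
pose q (fl : bool -> bool -> bool -> Z) a b c d e :=
  fl (W a d) (W b d) (W c d) * fl (W a e) (W b e) (W c e).
pose P6 (a b c d e : V) := b2z [&& ~~ W a b, ~~ W a c & W b c] *
   (200%coqZ * q flag1 a b c d e + 175%coqZ * q flag2 a b c d e
    + 1200%coqZ * q flag3 a b c d e + 36000%coqZ * q flag4 a b c d e).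
have -> : sum5 (fun a b c d e => psi (W a b) (W a c) (W a d) (W a e)
         (W b c) (W b d) (W b e) (W c d) (W c e) (W d e)) =
     sum5 P1 - sum5 P2 - sum5 P3 - sum5 P4 - sum5 P5 - sum5 P6.
  by rewrite -!sum5N -!sum5D.
have b2z_ge0 b : 0 <= b2z b by case: b.
(* For fixed roots the sum over [d] and [e] of each product of flags is the square of a sum over one
   vertex. *)
have P6ge0 : 0 <= sum5 P6.
  apply: sum5_ge0 => a b c.
  have qge0 fl : 0 <= \sum_d \sum_e q fl a b c d e.
    by rewrite sum2_mul -expr2 sqr_ge0.
  under eq_bigr => d _ do rewrite -big_distrr /=.
  rewrite -big_distrr mulr_ge0 //.
  rewrite (eq_bigr (fun d => 200%coqZ * (\sum_e q flag1 a b c d e) + 175%coqZ * (\sum_e q flag2 a b c d e)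
    + 1200%coqZ * (\sum_e q flag3 a b c d e) + 36000%coqZ * (\sum_e q flag4 a b c d e))); last first.
    by move=> d _; rewrite !big_distrr -!big_split.
  by rewrite !big_split -!big_distrr /= !addr_ge0 // mulr_ge0.
have P5ge0 : 0 <= sum5 P5.
  rewrite /sum5 sumr_ge0 // => a _.
  have -> : \sum_b \sum_c \sum_d \sum_e P5 a b c d e =
     480%coqZ * (\sum_b \sum_c r a b c) ^+ 2.
    rewrite expr2 !big_distrl big_distrr /=; apply: eq_bigr => b _.
    rewrite big_distrl big_distrr /=; apply: eq_bigr => c _.
    by do 2 (rewrite !big_distrr /=; apply: eq_bigr => ? _).
  by rewrite mulr_ge0 // sqr_ge0.
(* The cut condition, for the common neighbourhood of [a], [b], [c] and for that of [b], [c]. *)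
have P4ge0 : 0 <= sum5 P4.
  apply: sum5_ge0 => a b c.
  under eq_bigr => d _ do rewrite -big_distrr /=.
  rewrite -big_distrr mulr_ge0 ?b2z_ge0 //=.
  have c1 := @cut_ge0 (fun d => [&& W a d, W b d & W c d]) _ (fun d => erefl).
  have c2 := @cut_ge0 (fun d => W b d && W c d) _ (fun d => erefl).
  set X := (X in 0 <= X).
  suff -> : X = 261000%coqZ * \sum_x \sum_y b2z [&& W a x, W b x & W c x] *
      b2z (~~ [&& W a y, W b y & W c y]) * (1 - 2%:R * b2z (W x y)) +
      225000%coqZ * \sum_x \sum_y b2z (W b x && W c x) * b2z (~~ (W b y && W c y)) *
        (1 - 2%:R * b2z (W x y)).
    by rewrite addr_ge0 // mulr_ge0.
  rewrite /X !big_distrr -big_split; apply: eq_bigr => x _ /=.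
  rewrite !big_distrr -big_split; apply: eq_bigr => y _ /=.
  by rewrite mulrDl !mulrA.
have cntZ : \sum_d \sum_e b2z (W d e) = (cnt2 W)%:R.
  by rewrite natr_sum; apply: eq_bigr => x _; rewrite natr_sum; apply: eq_bigr => y _; rewrite b2zE.
have cst (z : Z) : \sum_(d in V) z = n * z.
  by rewrite sumr_const -[LHS]mulr_natl.
(* The edge density is at least .1249 by hypothesis, and .1249 times 91440 exceeds 11420. *)
have P3ge0 : 0 <= sum5 P3.
  apply: sum5_ge0 => a b c.
  under eq_bigr => d _ do rewrite -big_distrr /=.
  rewrite -big_distrr mulr_ge0 ?b2z_ge0 //=.
  under eq_bigr => d _ do rewrite sumrB -big_distrr /=.
  rewrite sumrB -big_distrr /= cntZ !cst.
  move: dens; rewrite -/n expr2; lia.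
have P1E : sum5 P1 = n ^+ 2 * (72000%coqZ * (cnt3 (fun x y z => W x y (+) W y z (+) W x z))%:R).
  rewrite sum5_mulr; congr (_ * _); rewrite /cnt3 natr_sum big_distrr /=.
  apply: eq_bigr => a _; rewrite natr_sum big_distrr /=.
  apply: eq_bigr => b _; rewrite natr_sum big_distrr /=.
  by apply: eq_bigr => c _; rewrite b2zE.
(* The constant 10836 is 72000 times .1505. *)
have P2E : sum5 P2 = n ^+ 2 * (10836%coqZ * n ^+ 3).
  by rewrite sum5_mulr !cst; ring.
move=> h; have {}h : 0 <= n ^+ 2 * (72000%coqZ * (cnt3 (fun x y z => W x y (+) W y z (+) W x z))%:R
     - 10836%coqZ * n ^+ 3).
  rewrite mulrBr -P1E -P2E; move: h P3ge0 P4ge0 P5ge0 P6ge0; lia.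
have [n0|n_gt0] := posnP #|V|; first by rewrite n0 expr0n mulr0 mulr_ge0.
move: h; rewrite pmulr_rge0; last by rewrite exprn_gt0 // ltr0n.
by rewrite -/n; lia.
Qed.

End Seidel.

Lemma exists_choice (X Y : Type) (P : X -> Y -> Prop) :
  (forall x, exists y, P x y) -> exists f, forall x, P x (f x).
Proof. by move=> /choice[f hf]; exists f. Qed.

Lemma addb_eq0 (a b : bool) : a (+) b = false -> a = b.
Proof. by case: a b => [] []. Qed.

(** * Fillings of mod 2 cochains *)

Section Cochains.
Variable V : finType.

Definition alt2 (f : V -> V -> bool) : Prop :=
  (forall a b, f a b = f b a) /\ (forall a, f a a = false).
Definition alt3 (f : V -> V -> V -> bool) : Prop :=
  [/\ forall a b c, f a b c = f b a c, forall a b c, f a b c = f a c b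
    & forall a b, f a a b = false].
(* Only the conditions which say that every link [f a] satisfies [alt3]. *)
Definition alt4 (f : V -> V -> V -> V -> bool) : Prop :=
  [/\ forall a b c d, f a b c d = f a c b d,
      forall a b c d, f a b c d = f a b d c
    & forall a b c, f a b b c = false].

Definition delta1 (f : V -> bool) (a b : V) : bool := f a (+) f b.
Definition delta2 (f : V -> V -> bool) (a b c : V) : bool :=
  f a b (+) f b c (+) f a c.
Definition delta3 (f : V -> V -> V -> bool) (a b c d : V) : bool :=
  f b c d (+) f a c d (+) f a b d (+) f a b c.
Definition delta4 (f : V -> V -> V -> V -> bool) (a b c d e : V) : bool :=
  f b c d e (+) f a c d e (+) f a b d e (+) f a b c e (+) f a b c d.

Lemma cnt1_eq0 (f : V -> bool) : cnt1 f = 0%N -> forall a, f a = false.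
Proof.
move=> /eqP; rewrite sum_nat_eq0 => /forallP h a.
by have := h a; case: (f a).
Qed.

Lemma cnt2_eq0 (f : V -> V -> bool) : cnt2 f = 0%N -> forall a b, f a b = false.
Proof.
move=> /eqP; rewrite sum_nat_eq0 => /forallP h a.
by apply: cnt1_eq0; apply/eqP; apply: h.
Qed.

Lemma cnt3_eq0 (f : V -> V -> V -> bool) :
  cnt3 f = 0%N -> forall a b c, f a b c = false.
Proof.
move=> /eqP; rewrite sum_nat_eq0 => /forallP h a.
by apply: cnt2_eq0; apply/eqP; apply: h.
Qed.

Lemma cnt1_addb (f g : V -> bool) :
  (cnt1 (fun a => f a (+) g a) <= cnt1 f + cnt1 g)%N.
Proof. by rewrite -big_split; apply: leq_sum => a _; case: (f a) (g a) => [] []. Qed.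

Lemma cnt2_addb (f g : V -> V -> bool) :
  (cnt2 (fun a b => f a b (+) g a b) <= cnt2 f + cnt2 g)%N.
Proof. by rewrite -big_split; apply: leq_sum => a _; apply: cnt1_addb. Qed.

Lemma cnt3_addb (f g : V -> V -> V -> bool) :
  (cnt3 (fun a b c => f a b c (+) g a b c) <= cnt3 f + cnt3 g)%N.
Proof. by rewrite -big_split; apply: leq_sum => a _; apply: cnt2_addb. Qed.

Lemma alt3_addb (f g : V -> V -> V -> bool) :
  alt3 f -> alt3 g -> alt3 (fun a b c => f a b c (+) g a b c).
Proof.
move=> [f1 f2 f0] [g1 g2 g0].
by split=> [a b c|a b c|a b]; [rewrite f1 g1|rewrite f2 g2|rewrite f0 g0].
Qed.

(* Coning from a vertex v fills F by its link at v, and #|V| times the least link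
   is at most the sum of all links. *)
Lemma filling3 (F : V -> V -> V -> V -> bool) : (0 < #|V|)%N ->
  alt4 F -> (forall a b c d e, delta4 F a b c d e = false) ->
  exists G, [/\ alt3 G, forall a b c d, delta3 G a b c d = F a b c d
              & (#|V| * cnt3 G <= cnt4 F)%N].
Proof.
move=> /card_gt0P[v0 _] [F1 F2 F0] cF.
pose v := [arg min_(x < v0) cnt3 (F x)]%N.
exists (F v); split.
- by split=> [a b c|a b c|a b]; [rewrite F1|rewrite F2|rewrite F0].
- move=> a b c d; have := cF v a b c d; rewrite /delta3 /delta4.
  by case: (F a b c d) (F v b c d) (F v a c d) (F v a b d) (F v a b c)
    => [] [] [] [] [].
- rewrite -sum_nat_const /cnt4; apply: leq_sum => a _.
  by rewrite /v; case: arg_minnP => // i _; apply.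
Qed.

(** The link of a vertex shows that a filling exists; [H] is one with the fewest edges. Adding the
    coboundary of [U] gives another filling, so [H] is minimal in its switching class. *)
Lemma filling2 (T : V -> V -> V -> bool) : (0 < #|V|)%N ->
  alt3 T -> (forall a b c d, delta3 T a b c d = false) ->
  exists H, [/\ alt2 H, forall a b c, delta2 H a b c = T a b c,
    forall U, (cnt2 H <= cnt2 (fun a b => H a b (+) (U a (+) U b)))%N
    & (forall a b c, T a b c = false) -> cnt2 H = 0%N].
Proof.
move=> /card_gt0P[v _] [T1 T2 T0] cT.
pose fills H := alt2 H /\ forall a b c, delta2 H a b c = T a b c.
pose P k := `[< exists2 H, fills H & cnt2 H = k >].
have exP : exists k, P k.
  exists (cnt2 (T v)); apply/asboolP; exists (T v) => //; split.
    by split=> [a b|a]; [rewrite T2|rewrite T1 T2 T0].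
  move=> a b c; have := cT v a b c; rewrite /delta2 /delta3.
  by case: (T a b c) (T v b c) (T v a c) (T v a b) => [] [] [] [].
case: (ex_minnP exP) => k /asboolP[H [altH dH] <-] minH.
exists H; split=> // [U|T00].
  apply: minH; apply/asboolP; eexists; last by []; split.
    case: altH => HC H0; split=> [a b|a]; last by rewrite H0; case: (U a).
    by rewrite HC [U a (+) _]addbC.
  move=> a b c; rewrite -dH /delta2.
  by case: (H a b) (H b c) (H a c) (U a) (U b) (U c) => [] [] [] [] [] [].
apply/eqP; rewrite -leqn0; apply: minH; apply/asboolP.
exists (fun _ _ => false); last by apply: big1 => a _; apply: big1.
by split=> // a b c; rewrite T00.
Qed.

Lemma cnt1_neg (f : V -> bool) : (cnt1 f + cnt1 (fun a => ~~ f a) = #|V|)%N.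
Proof.
rewrite -big_split /= -sum1_card; apply: eq_bigr => a _.
by case: (f a).
Qed.

Lemma cnt2_delta1 (f : V -> bool) :
  cnt2 (delta1 f) = (2 * (cnt1 f * cnt1 (fun a => ~~ f a)))%N.
Proof.
have E (g h : V -> bool) : (cnt1 g * cnt1 h = \sum_a \sum_b (g a && h b : nat))%N.
  rewrite big_distrlr /=; apply: eq_bigr => a _; apply: eq_bigr => b _.
  by case: (g a) (h b) => [] [].
rewrite mul2n -addnn {2}mulnC !E -big_split; apply: eq_bigr => a _ /=.
rewrite -big_split; apply: eq_bigr => b _ /=.
by rewrite /delta1; case: (f a) (f b) => [] [].
Qed.

(** Both the link of a vertex and its complement are fillings, and one of them has at most half of
    the points. *)
Lemma filling1 (T : V -> V -> bool) : (0 < #|V|)%N ->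
  (forall a b c, delta2 T a b c = false) ->
  exists K, [/\ forall a b, delta1 K a b = T a b, (2 * cnt1 K <= #|V|)%N
              & (forall a b, T a b = false) -> cnt1 K = 0%N].
Proof.
move=> n0 cT.
have [K [dK halfK]] : exists K, (forall a b, delta1 K a b = T a b) /\
    (2 * cnt1 K <= #|V|)%N.
  have /card_gt0P[v _] := n0.
  have [h|h] := leqP (2 * cnt1 (T v)) #|V|.
    exists (T v); split=> // a b; have := cT v a b; rewrite /delta1 /delta2.
    by case: (T a b) (T v a) (T v b) => [] [] [].
  exists (fun a => ~~ T v a); split; last by have := cnt1_neg (T v); lia.
  move=> a b; have := cT v a b; rewrite /delta1 /delta2.
  by case: (T a b) (T v a) (T v b) => [] [] [].
exists K; split=> // T0.
(* With k the size of [K], [2 k (n - k) = 0], [2 k <= n] and [n > 0] force [k = 0]. *)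
have : cnt2 (delta1 K) = 0%N by apply: big1 => a _; apply: big1 => b _; rewrite dK T0.
by have := cnt1_neg K; rewrite cnt2_delta1; nia.
Qed.

End Cochains.

(** * Successive fillings over vertices, edges and triangles *)

Section Assembly.
Variables (V : finType) (X : Type) (D : X -> Prop).
Variable F0 : X -> V -> V -> V -> V -> bool.
Variable F1 : X -> X -> V -> V -> V -> bool.
Variable F2 : X -> X -> X -> V -> V -> bool.
Variable F3 : X -> X -> X -> X -> V -> bool.
Let n : Z := #|V|%:R.
Hypothesis n_large : 15000%coqZ <= n.
Hypothesis F0alt : forall x, D x -> alt4 (F0 x).
Hypothesis F1alt : forall x y, D x -> D y -> alt3 (F1 x y).
Hypothesis F0d : forall x, D x -> forall a b c d e, delta4 (F0 x) a b c d e = false.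
Hypothesis F1d : forall x y, D x -> D y -> forall a b c d,
  delta3 (F1 x y) a b c d = F0 x a b c d (+) F0 y a b c d.
Hypothesis F2d : forall x y z, D x -> D y -> D z -> forall a b c,
  delta2 (F2 x y z) a b c = F1 x y a b c (+) F1 x z a b c (+) F1 y z a b c.
Hypothesis F3d : forall x y z w, D x -> D y -> D z -> D w -> forall a b,
  delta1 (F3 x y z w) a b =
    F2 y z w a b (+) F2 x z w a b (+) F2 x y w a b (+) F2 x y z a b.
Hypothesis F0small : forall x, D x -> 40%coqZ * (cnt4 (F0 x))%:R <= 3%coqZ * n ^+ 4.

Let small1 x y := (cnt3 (F1 x y))%:R <= 7%coqZ * n ^+ 2.
Let small2 x y z := (cnt2 (F2 x y z))%:R <= 3%coqZ * n.

Let V_gt0 : (0 < #|V|)%N.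
Proof. by rewrite lt0n; apply/eqP => V0; move: n_large; rewrite /n V0. Qed.

(** Fillings will be global functions of a vertex, an ordered edge or an ordered triangle, so that
    tetrahedra sharing a face use the same one. The last clause, that zero data have a zero filling,
    serves on the boundary of the box. *)
Definition vertex_filling (x : X) (g : V -> V -> V -> bool) : Prop := D x ->
  [/\ alt3 g, forall a b c d, delta3 g a b c d = F0 x a b c d,
    40%coqZ * (cnt3 g)%:R <= 3%coqZ * n ^+ 3
    & (forall a b c d, F0 x a b c d = false) -> forall a b c, g a b c = false].

Definition edge_filling (G : X -> V -> V -> V -> bool) (e : X * X)
    (h : V -> V -> bool) : Prop := D e.1 -> D e.2 ->
  [/\ forall a b c, delta2 h a b c =
        G e.1 a b c (+) G e.2 a b c (+) F1 e.1 e.2 a b c,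
    small1 e.1 e.2 -> 10000%coqZ * (cnt2 h)%:R <= 1249%coqZ * n ^+ 2
    & (forall a b c d, F0 e.1 a b c d = false) ->
      (forall a b c d, F0 e.2 a b c d = false) ->
      (forall a b c, F1 e.1 e.2 a b c = false) -> forall a b, h a b = false].

Definition triangle_filling (H : X * X -> V -> V -> bool) (t : X * X * X)
    (k : V -> bool) : Prop := D t.1.1 -> D t.1.2 -> D t.2 ->
  [/\ forall a b, delta1 k a b = H (t.1.1, t.1.2) a b (+) H (t.1.1, t.2) a b
        (+) H (t.1.2, t.2) a b (+) F2 t.1.1 t.1.2 t.2 a b,
    small1 t.1.1 t.1.2 -> small1 t.1.1 t.2 -> small1 t.1.2 t.2 ->
      small2 t.1.1 t.1.2 t.2 -> 4%coqZ * (cnt1 k)%:R <= n - 2%coqZ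
    & (forall a b, H (t.1.1, t.1.2) a b = false) ->
      (forall a b, H (t.1.1, t.2) a b = false) ->
      (forall a b, H (t.1.2, t.2) a b = false) ->
      (forall a b, F2 t.1.1 t.1.2 t.2 a b = false) -> forall a, k a = false].

Lemma vertex_fillings : exists G : X -> V -> V -> V -> bool, forall x, vertex_filling x (G x).
Proof.
apply: (exists_choice (P := vertex_filling)) => x.
have [Dx|nDx] := pselect (D x); last by exists (fun _ _ _ => false).
have [G [altG dG leG]] := filling3 V_gt0 (F0alt Dx) (F0d Dx).
exists G => _; split=> //.
  have := F0small Dx; move: leG; rewrite -(ler_nat Z) natrM -/n.
  set g := (cnt3 G)%:R; set f := (cnt4 _)%:R => h1 h2.
  have n0 : 0 < n by move: n_large; lia.
  by rewrite -(ler_pM2l n0); move: h1 h2; rewrite !exprS expr0 mulr1; lia.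
move=> F00; apply: cnt3_eq0; move: leG.
have -> : cnt4 (F0 x) = 0%N by do 4 (apply: big1 => ? _); rewrite F00.
by rewrite leqn0 muln_eq0 => /orP[/eqP V0|/eqP //]; move: V_gt0; rewrite V0.
Qed.

Lemma edge_fillings (G : X -> V -> V -> V -> bool) :
  (forall x, vertex_filling x (G x)) ->
  exists H : X * X -> V -> V -> bool, forall e, edge_filling G e (H e).
Proof.
move=> hG; apply: (exists_choice (P := edge_filling G)) => -[x y]; rewrite /edge_filling /=.
have [Dx|nDx] := pselect (D x); last by exists (fun _ _ => false).
have [Dy|nDy] := pselect (D y); last by exists (fun _ _ => false).
have [altGx dGx leGx G0x] := hG x Dx.
have [altGy dGy leGy G0y] := hG y Dy.
pose T a b c := G x a b c (+) G y a b c (+) F1 x y a b c.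
have altT : alt3 T by apply: alt3_addb; [apply: alt3_addb|apply: F1alt].
have cT a b c d : delta3 T a b c d = false.
  have := F1d Dx Dy a b c d; rewrite -dGx -dGy /delta3 /T => e.
  rewrite [LHS](AC ((3*3)*3*3) ((1*4*7*10)*(2*5*8*11)*(3*6*9*12)))/= e.
  exact: addbb.
have [H [altH dH minH H0]] := filling2 V_gt0 altT cT.
exists H => _ _; split=> //.
  rewrite /small1 => le1; rewrite leNgt; apply/negP => lt.
  (* Were [H] too dense, [T] would have at least .1505 n^3 triples, but it has at most .15 n^3 + 7
     n^2; for n >= 15000 this is absurd, as .0005 n > 7. *)
  have := odd_triples_lower_bound altH.1 minH (ltW lt).
  have -> : cnt3 (fun x0 y0 z => H x0 y0 (+) H y0 z (+) H x0 z) = cnt3 T.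
    apply: eq_bigr => a _; apply: eq_bigr => b _; apply: eq_bigr => c _.
    by rewrite -dH.
  have : (cnt3 T <= cnt3 (G x) + cnt3 (G y) + cnt3 (F1 x y))%N.
    apply: leq_trans (cnt3_addb _ _) _; rewrite leq_add2r; exact: cnt3_addb.
  rewrite -/n -(ler_nat Z) !natrD.
  move: leGx leGy le1; rewrite !exprS expr0 mulr1.
  set gx := (cnt3 (G x))%:R; set gy := (cnt3 (G y))%:R; set f := (cnt3 (F1 x y))%:R.
  set t := (cnt3 T)%:R => h1 h2 h3 h4 h5.
  have h6 : 15000%coqZ * (n * n) <= n * (n * n).
    by apply: ler_wpM2r; rewrite // mulr_ge0.
  have : 0 < n * n by rewrite mulr_gt0 //; lia.
  lia.
move=> F0x F0y F1xy; apply: cnt2_eq0; apply: H0 => a b c.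
by rewrite /T G0x // G0y // F1xy.
Qed.

Lemma triangle_fillings (G : X -> V -> V -> V -> bool) (H : X * X -> V -> V -> bool) :
  (forall e, edge_filling G e (H e)) ->
  exists K : X * X * X -> V -> bool, 
    forall t, triangle_filling H t (K t).
Proof.
move=> hH; apply: (exists_choice (P := triangle_filling H)) => -[[x y] z]; rewrite /triangle_filling /=.
have [Dx|nDx] := pselect (D x); last by exists (fun _ => false).
have [Dy|nDy] := pselect (D y); last by exists (fun _ => false).
have [Dz|nDz] := pselect (D z); last by exists (fun _ => false).
have [dxy lexy _] := hH (x, y) Dx Dy.
have [dxz lexz _] := hH (x, z) Dx Dz.
have [dyz leyz _] := hH (y, z) Dy Dz.
pose T a b := H (x, y) a b (+) H (x, z) a b (+) H (y, z) a b (+) F2 x y z a b.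
(* Each vertex filling [G] occurs for two edges of the triangle and cancels; the terms [F1] cancel
   against the coboundary of [F2]. *)
have cT a b c : delta2 T a b c = false.
  have := F2d Dx Dy Dz a b c.
  have := dxy a b c; have := dxz a b c; have := dyz a b c; rewrite /delta2 /T /=.
  move: (H (x, y) a b) (H (x, y) b c) (H (x, y) a c)
        (H (x, z) a b) (H (x, z) b c) (H (x, z) a c)
        (H (y, z) a b) (H (y, z) b c) (H (y, z) a c)
        (F2 x y z a b) (F2 x y z b c) (F2 x y z a c) => h1 h2 h3 h4 h5 h6 h7 h8 h9 f1 f2 f3.
  move: (G x a b c) (G y a b c) (G z a b c) (F1 x y a b c) (F1 x z a b c) (F1 y z a b c)
    => gx gy gz k1 k2 k3 e1 e2 e3 e4.
  have -> : h1 (+) h4 (+) h7 (+) f1 (+) (h2 (+) h5 (+) h8 (+) f2)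
     (+) (h3 (+) h6 (+) h9 (+) f3) = (h1 (+) h2 (+) h3) (+) (h4 (+) h5 (+) h6)
     (+) (h7 (+) h8 (+) h9) (+) (f1 (+) f2 (+) f3).
    by rewrite [LHS](AC (4*4*4) ((1*5*9)*(2*6*10)*(3*7*11)*(4*8*12))).
  rewrite e1 e2 e3 e4; clear.
  by move: gx gy gz k1 k2 k3 => [] [] [] [] [] [].
have [K [dK halfK K0]] := filling1 V_gt0 cT.
exists K => _ _ _; split=> //; last first.
  by move=> Hxy Hxz Hyz F2xyz; apply: cnt1_eq0; apply: K0 => a b; rewrite /T Hxy Hxz Hyz F2xyz.
move=> sxy sxz syz; rewrite /small2 => s2.
have := lexy sxy; have := lexz sxz; have := leyz syz.
have : (cnt2 T <= cnt2 (H (x, y)) + cnt2 (H (x, z)) + cnt2 (H (y, z)) + cnt2 (F2 x y z))%N.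
  do 2 (apply: leq_trans (cnt2_addb _ _) _; rewrite leq_add2r).
  exact: cnt2_addb.
have -> : cnt2 T = cnt2 (delta1 K).
  by apply: eq_bigr => a _; apply: eq_bigr => b _; rewrite dK.
rewrite cnt2_delta1 -(ler_nat Z) !natrD !natrM.
have := cnt1_neg K => /(congr1 (fun k => k%:R : Z)); rewrite natrD -/n.
move: halfK; rewrite -(ler_nat Z) natrM -/n.
move: s2 n_large; rewrite expr2.
set k := (cnt1 K)%:R; set k' := (cnt1 _)%:R; set h1 := (cnt2 (H (x, y)))%:R.
set h2 := (cnt2 (H (x, z)))%:R; set h3 := (cnt2 (H (y, z)))%:R; set f := (cnt2 (F2 _ _ _))%:R.
move=> s2 nl halfk kn le1 le2 le3 le4.
have k0 : 0 <= k by [].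
rewrite leNgt; apply/negP => lt.
(* From [n - 1 <= 4 k <= 3 n + 1] the product of the two slacks gives
   [16 k (n - k) >= (n - 1) (3 n + 1)]. This contradicts [2 k (n - k) <= .3747 n^2 + 3 n] for n >=
   15000. *)
have {}lt : 0 <= 4%coqZ * k - (n - 1) by lia.
have h : 0 <= 2%coqZ * n + 2%coqZ - (4%coqZ * k - (n - 1)) by lia.
have := mulr_ge0 lt h.
move: le1; have -> : k' = n - k by lia.
have : 15000%coqZ * n <= n * n by apply: ler_wpM2r => //; lia.
clear -le2 le3 le4 s2 nl; nia.
Qed.

Lemma assembly : exists K : X -> X -> X -> V -> bool,
  (forall x y z w, D x -> D y -> D z -> D w ->
    small1 x y -> small1 x z -> small1 x w -> small1 y z -> small1 y w -> small1 z w ->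
    small2 x y z -> small2 x y w -> small2 x z w -> small2 y z w ->
    (cnt1 (F3 x y z w) <= 1)%N ->
    forall a, K y z w a (+) K x z w a (+) K x y w a (+) K x y z a = F3 x y z w a) /\
  (forall x y z, D x -> D y -> D z ->
    (forall v, v = x \/ v = y \/ v = z -> forall a b c d, F0 v a b c d = false) ->
    (forall a b c, F1 x y a b c = false) -> (forall a b c, F1 x z a b c = false) ->
    (forall a b c, F1 y z a b c = false) -> (forall a b, F2 x y z a b = false) ->
    forall a, K x y z a = false).
Proof.
have [G hG] := vertex_fillings.
have [H hH] := edge_fillings hG.
have [K hK] := triangle_fillings hH.
exists (fun x y z => K (x, y, z)); split; last first.
  move=> x y z Dx Dy Dz F00 F1xy F1xz F1yz F2xyz a.
  have [_ _ K0] := hK (x, y, z) Dx Dy Dz.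
  have [_ _ Hxy] := hH (x, y) Dx Dy.
  have [_ _ Hxz] := hH (x, z) Dx Dz.
  have [_ _ Hyz] := hH (y, z) Dy Dz.
  have F0x := F00 x (or_introl erefl).
  have F0y := F00 y (or_intror (or_introl erefl)).
  have F0z := F00 z (or_intror (or_intror erefl)).
  by apply: K0 => //= b c; [apply: Hxy|apply: Hxz|apply: Hyz].
move=> x y z w Dx Dy Dz Dw sxy sxz sxw syz syw szw sxyz sxyw sxzw syzw sF3.
have [d1 l1 _] := hK (x, y, z) Dx Dy Dz; have {l1} := l1 sxy sxz syz sxyz.
have [d2 l2 _] := hK (x, y, w) Dx Dy Dw; have {l2} := l2 sxy sxw syw sxyw.
have [d3 l3 _] := hK (x, z, w) Dx Dz Dw; have {l3} := l3 sxz sxw szw sxzw.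
have [d4 l4 _] := hK (y, z, w) Dy Dz Dw; have {l4} := l4 syz syw szw syzw.
move=> l4 l3 l2 l1.
pose S a := K (y, z, w) a (+) K (x, z, w) a (+) K (x, y, w) a (+) K (x, y, z) a
  (+) F3 x y z w a.
have dS a b : S a = S b.
  apply: addb_eq0.
  have := F3d Dx Dy Dz Dw a b.
  have := d1 a b; have := d2 a b; have := d3 a b; have := d4 a b.
  rewrite /delta1 /S /=.
  move: (K (y, z, w) a) (K (x, z, w) a) (K (x, y, w) a) (K (x, y, z) a) (F3 x y z w a)
    (K (y, z, w) b) (K (x, z, w) b) (K (x, y, w) b) (K (x, y, z) b) (F3 x y z w b)
    => k1 k2 k3 k4 f k1' k2' k3' k4' f' e1 e2 e3 e4 e5.
  have -> : k1 (+) k2 (+) k3 (+) k4 (+) f (+) (k1' (+) k2' (+) k3' (+) k4' (+) f') =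
    (k1 (+) k1') (+) (k2 (+) k2') (+) (k3 (+) k3') (+) (k4 (+) k4') (+) (f (+) f').
    by rewrite [LHS](AC (5*5) ((1*6)*(2*7)*(3*8)*(4*9)*(5*10))).
  rewrite e1 e2 e3 e4 e5; clear.
  move: (H (x, y) a b) (H (x, z) a b) (H (x, w) a b) (H (y, z) a b) (H (y, w) a b) (H (z, w) a b).
  move: (F2 y z w a b) (F2 x z w a b) (F2 x y w a b) (F2 x y z a b).
  by do 8 case; case; case.
(* Four fillings of at most (n - 2)/4 points each and at most one point of [F3] leave a point
   uncovered; hence the form n - 2 of the bound. *)
have cS : (cnt1 S < #|V|)%N.
  have : (cnt1 S <= cnt1 (K (y, z, w)) + cnt1 (K (x, z, w)) + cnt1 (K (x, y, w))
     + cnt1 (K (x, y, z)) + cnt1 (F3 x y z w))%N.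
    do 3 (apply: leq_trans (cnt1_addb _ _) _; rewrite leq_add2r).
    exact: cnt1_addb.
  move: sF3; rewrite -(ltr_nat Z) -!(ler_nat Z) !natrD -/n.
  move: l1 l2 l3 l4; move: (cnt1 S)%:R (cnt1 (F3 x y z w))%:R (cnt1 (K _))%:R
    (cnt1 (K _))%:R (cnt1 (K _))%:R (cnt1 (K _))%:R => ? ? ? ? ? ?; clear; lia.
have [a0 Sa0] : exists a0, S a0 = false.
  apply/not_existsP => nS; move: cS; rewrite ltnNge -sum1_card => /negP; apply.
  by apply: leq_sum => a _; have := nS a; case: (S a).
move=> a; have := dS a a0; rewrite Sa0 /S.
exact: addb_eq0.
Qed.

End Assembly.

(** * Parity of intersections of simplices *)

Section OrthantParity.
Variables (R : realType) (m r : nat) (A : 'M[R]_(m, r)) (c : 'rV[R]_r).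
Hypothesis ltrm : (r < m)%N.
Hypothesis ker_neg : forall y : 'rV_m, y *m A = 0 -> y != 0 -> exists i, y 0 i < 0.

Definition feasible (z : 'rV[R]_m) : Prop := z *m A = c /\ forall i, 0 <= z 0 i.

Hypothesis no_two_zeros : forall z, feasible z ->
  forall i j, z 0 i = 0 -> z 0 j = 0 -> i = j.

(** The ratio test of linear programming: along [y] the first coordinate to reach 0 minimizes
    [z i / - y i] among those that decrease. *)
Lemma exit_facet (z y : 'rV[R]_m) : feasible z -> y *m A = 0 -> y != 0 ->
  exists t l, [/\ 0 <= t, y 0 l < 0, feasible (z + t *: y), (z + t *: y) 0 l = 0
    & forall i, y 0 i < 0 -> t <= z 0 i / - y 0 i].
Proof.
move=> [zA z0] yA /(ker_neg yA)[i0 yi0].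
pose l := [arg min_(i < i0 | y 0 i < 0) (z 0 i / - y 0 i)]%O.
have [yl lmin] : y 0 l < 0 /\ forall i, y 0 i < 0 -> z 0 l / - y 0 l <= z 0 i / - y 0 i.
  by rewrite /l; case: arg_minP.
have t0 : 0 <= z 0 l / - y 0 l by rewrite divr_ge0 // oppr_ge0 ltW.
exists (z 0 l / - y 0 l), l; split=> //; last first.
  by rewrite !mxE invrN mulrN mulNr divfK ?subrr // lt_eqF.
split; first by rewrite mulmxDl -scalemxAl yA scaler0 addr0.
move=> i; rewrite !mxE; have [yi|yi] := ltP (y 0 i) 0; last by rewrite addr_ge0 // mulr_ge0.
have := lmin _ yi; rewrite ler_pdivlMr ?oppr_gt0 // mulrN; lra.
Qed.

(* The feasible set is empty or a segment with its two ends on one facet each. *)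
Lemma orthant_parity :
  \big[addb/false]_(i < m) `[< exists z, feasible z /\ z 0 i = 0 >] = false.
Proof.
have [[k [z [fz zk]]]|nohit] := pselect (exists i z, feasible z /\ z 0 i = 0); last first.
  by apply: big1 => i _; apply/asboolP => h; apply: nohit; exists i.
have [zA z0] := fz.
(* Moving from [z] along a nonzero such [y] would keep coordinate [k] at 0 and reach a second zero.
   Hence a kernel vector is determined by its coordinate [k]. *)
have ker_k (y : 'rV[R]_m) : y *m A = 0 -> y 0 k = 0 -> y = 0.
  move=> yA yk; apply: contrapT => /eqP yn0.
  have [t [l [_ yl fl zl _]]] := exit_facet fz yA yn0.
  have lk : l = k by apply: no_two_zeros fl _ _ zl _; rewrite !mxE zk yk mulr0 addr0.
  by move: yl; rewrite lk yk ltxx.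
(* The kernel is nonzero because [r < m]; the sign of [y] is chosen so that it leaves the facet
   [k]. *)
have [y [yA yk]] : exists y : 'rV_m, y *m A = 0 /\ 0 < y 0 k.
  have /rowV0Pn[y /sub_kermxP yA yn0] : kermx A != 0.
    by rewrite -mxrank_eq0 mxrank_ker subn_eq0 -ltnNge (leq_ltn_trans (rank_leq_col A)).
  have [yk|yk|yk] := ltrgtP (y 0 k) 0; last by move: yn0; rewrite (ker_k y yA yk) eqxx.
    by exists (- y); rewrite mulNmx yA oppr0 mxE oppr_gt0.
  by exists y.
have yn0 : y != 0 by apply: contraL yk => /eqP ->; rewrite mxE ltxx.
have [t [l [t0 yl fl zl tmin]]] := exit_facet fz yA yn0.
have lk : l != k by apply: contraTneq yl => ->; rewrite -leNgt ltW.
have hitE i : `[< exists z', feasible z' /\ z' 0 i = 0 >] = (i == k) || (i == l).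
  apply/asboolP/orP => [[z' [[z'A z'0] z'i]]|[/eqP ->|/eqP ->]]; last 2 first.
  - by exists z.
  - by exists (z + t *: y).
  (* Every feasible point is [z + s y] with [0 <= s <= t], and it can touch a facet only at an end
     of this segment. *)
  pose s := z' 0 k / y 0 k.
  have z'E : z' = z + s *: y.
    apply/eqP; rewrite -subr_eq0; apply/eqP; apply: ker_k.
      by rewrite mulmxBl mulmxDl -scalemxAl yA scaler0 addr0 z'A zA subrr.
    by rewrite !mxE zk add0r divfK ?subrr // gt_eqF.
  have s0 : 0 <= s by rewrite divr_ge0 // ltW.
  have st : s <= t.
    have := z'0 l; rewrite z'E -zl !mxE => h.
    by have := yl; nra.
  have := z'i; rewrite z'E !mxE => /eqP.
  have [yi|yi] := leP 0 (y 0 i).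
    rewrite paddr_eq0 ?(mulr_ge0 s0) // => /andP[/eqP zi _]; left.
    by apply/eqP; apply: no_two_zeros fz _ _ zi zk.
  move=> /eqP zi; right; apply/eqP.
  have := tmin _ yi; rewrite ler_pdivlMr ?oppr_gt0 // => ht.
  have sE : s = t by nra.
  by apply: no_two_zeros fl _ _ _ zl; rewrite !mxE -sE.
under eq_bigr do rewrite hitE.
rewrite (bigD1 k) //= (bigD1 l) //= !eqxx orbT /= big1 // => i /andP[/negPf -> /negPf ->] //.
Qed.

End OrthantParity.

(** * Convex hulls of finite sequences *)

Section Hull.
Variables (R : realType) (d : nat).
Local Notation pt := 'rV[R]_d.
Implicit Types (s : seq pt) (x : pt) (w : nat -> R).

(** Weights belong to positions, not to points, so that a sequence may repeat a point. *)
Definition weights s w x : Prop :=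
  [/\ forall i, 0 <= w i, \sum_(i < size s) w i = 1
    & x = \sum_(i < size s) w i *: s`_i].

Definition hull s : set pt := [set x | exists w, weights s w x]%classic.

Definition sub_seq (P : pred nat) s := [seq s`_i | i <- iota 0 (size s) & P i].

Definition facet (k : nat) s := sub_seq (predC1 k) s.

Definition meet s1 s2 : Prop := exists x, hull s1 x /\ hull s2 x.

Lemma sum_iota (T : zmodType) n (F : nat -> T) :
  \sum_(i < n) F i = \sum_(i <- iota 0 n) F i.
Proof. by rewrite -(big_mkord xpredT) /index_iota subn0. Qed.

Lemma sum_sub_seq (T : zmodType) (l : seq nat) (F : nat -> T) :
  \sum_(i < size l) F (nth 0%N l i) = \sum_(i <- l) F i.
Proof. by rewrite (big_nth 0%N) big_mkord. Qed.

Lemma hull_sub_seqP P s x : hull (sub_seq P s) x <->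
  exists w, weights s w x /\ forall i, (i < size s)%N -> ~~ P i -> w i = 0.
Proof.
set l := [seq i <- iota 0 (size s) | P i].
have ul : uniq l by rewrite filter_uniq // iota_uniq.
have szl : size (sub_seq P s) = size l by rewrite size_map.
have nthl i : (i < size l)%N -> (sub_seq P s)`_i = s`_(nth 0%N l i).
  by move=> il; rewrite (nth_map 0%N).
have suml (T : zmodType) (F : nat -> T) : (forall i, (i < size s)%N -> ~~ P i -> F i = 0) ->
    \sum_(i < size s) F i = \sum_(i <- l) F i.
  move=> F0; rewrite sum_iota big_filter [RHS]big_mkcond /=; apply: eq_big_seq => i.
  by rewrite mem_iota /= add0n => il; case: ifPn => // /F0 ->.
split=> [[w [w0 w1 ->]]|[w [[w0 w1 ->] wP]]].
  pose w' i := if i \in l then w (index i l) else 0.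
  have w'P i : (i < size s)%N -> ~~ P i -> w' i = 0.
    by move=> il Pi; rewrite /w' mem_filter (negPf Pi).
  exists w'; split=> //; split.
  - by move=> i; rewrite /w'; case: ifP.
  - rewrite (suml _ w') // -w1 szl -sum_sub_seq; apply: eq_bigr => i _.
    by rewrite /w' mem_nth // index_uniq.
  - rewrite (suml _ (fun i => w' i *: s`_i)) => [|i il Pi]; last by rewrite w'P // scale0r.
    rewrite szl -sum_sub_seq; apply: eq_bigr => i _.
    by rewrite nthl // /w' mem_nth // index_uniq.
exists (fun i => w (nth 0%N l i)); split.
- by move=> i.
- by rewrite szl (sum_sub_seq l w) -suml // w1.
- rewrite (suml _ (fun i => w i *: s`_i)) => [|i il Pi]; last by rewrite wP // scale0r.
  rewrite szl -sum_sub_seq; apply: eq_bigr => i _.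
  by rewrite nthl.
Qed.

Lemma hull_subset s s' x : {subset s <= s'} -> hull s x -> hull s' x.
Proof.
move=> ss' [w [w0 w1 ->]].
(* The weights of all positions carrying the same point are gathered at its first position in
   [s']. *)
pose w' j := \sum_(i < size s | index s`_i s' == j) w i.
have idx (i : 'I_(size s)) : (index (s`_i)%R s' < size s')%N.
  by rewrite index_mem ss' // mem_nth.
exists w'; split.
- by move=> j; apply: sumr_ge0.
- rewrite -w1 (partition_big (fun i => Ordinal (idx i)) xpredT) //=.
- rewrite (partition_big (fun i => Ordinal (idx i)) xpredT) //=.
  apply: eq_bigr => j _; rewrite scaler_suml; apply: eq_bigr => i /eqP <-.
  by rewrite /= nth_index // ss' // mem_nth.
Qed.

Lemma meet_subset s1 s1' s2 s2' : {subset s1 <= s1'} -> {subset s2 <= s2'} ->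
  meet s1 s2 -> meet s1' s2'.
Proof. by move=> h1 h2 [x [x1 x2]]; exists x; split; apply: hull_subset; eassumption. Qed.

Lemma hull_nil x : ~ hull [::] x.
Proof. by move=> [w [_ /eqP]]; rewrite big_ord0 eq_sym oner_eq0. Qed.

End Hull.

(** * Parity of the facets met by another simplex *)

Section MeetParity.
Variables (R : realType) (d : nat) (s1 s2 : seq 'rV[R]_d).
Hypothesis dim : (d + 2 < size s1 + size s2)%N.
Hypothesis transverse : forall t1 t2, {subset t1 <= s1} -> {subset t2 <= s2} ->
  (size t1 + size t2 <= size s1 + size s2 - 2)%N -> ~ meet t1 t2.

Let m := size s1.
Let n := size s2.
Let rows (s : seq 'rV[R]_d) : 'M[R]_(size s, d) := \matrix_(i < size s) s`_i.

(** In the unknown weights on [s1] and on [s2], the system with matrix [A] and right side [c] says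
    that both combinations give the same point and that each family of weights sums to 1. *)
Let A : 'M[R]_(m + n, d + (1 + 1)) :=
  row_mx (col_mx (rows s1) (- rows s2))
    (row_mx (col_mx (const_mx 1) 0) (col_mx 0 (const_mx 1))).

Let c : 'rV[R]_(d + (1 + 1)) := row_mx 0 (row_mx (const_mx 1) (const_mx 1)).

Let mulA (a : 'rV_m) (b : 'rV_n) : row_mx a b *m A =
  row_mx (\sum_i a 0 i *: s1`_i - \sum_j b 0 j *: s2`_j)
    (row_mx (const_mx (\sum_i a 0 i)) (const_mx (\sum_j b 0 j))).
Proof.
have const1 k (e : 'rV[R]_k) : e *m const_mx 1 = const_mx (\sum_i e 0 i) :> 'rV_1.
  by apply/matrixP => i j; rewrite !mxE; apply: eq_bigr => l _; rewrite !mxE mulr1 ord1.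
rewrite mul_mx_row mul_mx_row !mul_row_col mulmxN !mulmx0 addr0 add0r !const1.
by rewrite !mulmx_sum_row; congr (row_mx (_ - _) _); apply: eq_bigr => i _; rewrite rowK.
Qed.

Let ext k (a : 'rV[R]_k) (i : nat) : R := if insub i is Some j then a 0 j else 0.

Let extE k (a : 'rV[R]_k) (i : 'I_k) : ext a i = a 0 i.
Proof. by rewrite /ext valK. Qed.

Let ext_ge0 k (a : 'rV[R]_k) i : (forall j, 0 <= a 0 j) -> 0 <= ext a i.
Proof. by move=> a0; rewrite /ext; case: insub. Qed.

Let feasibleP (a : 'rV_m) (b : 'rV_n) : feasible A c (row_mx a b) <->
  exists x, weights s1 (ext a) x /\ weights s2 (ext b) x.
Proof.
have sE k (e : 'rV[R]_k) : \sum_(i < k) ext e i = \sum_i e 0 i.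
  by apply: eq_bigr => i _; rewrite extE.
have vE (s : seq 'rV[R]_d) (e : 'rV[R]_(size s)) :
    \sum_(i < size s) ext e i *: s`_i = \sum_i e 0 i *: s`_i.
  by apply: eq_bigr => i _; rewrite extE.
split=> [[]|[x [[a0 a1 ax] [b0 b1 bx]]]].
  rewrite mulA /c => /eq_row_mx[/eqP xy /eq_row_mx[/rowP/(_ 0) a1 /rowP/(_ 0) b1]] ab0.
  rewrite !mxE in a1 b1.
  have a0 i : 0 <= a 0 i by have := ab0 (lshift n i); rewrite row_mxEl.
  have b0 i : 0 <= b 0 i by have := ab0 (rshift m i); rewrite row_mxEr.
  rewrite subr_eq0 in xy.
  exists (\sum_i a 0 i *: s1`_i); split; split.
  - by move=> i; apply: ext_ge0.
  - by rewrite sE.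
  - by rewrite vE.
  - by move=> i; apply: ext_ge0.
  - by rewrite sE.
  - by rewrite vE (eqP xy).
rewrite sE in a1; rewrite sE in b1; rewrite vE in ax; rewrite vE in bx.
split; first by rewrite mulA a1 b1 -ax -bx subrr.
by move=> i; rewrite mxE; case: fintype.split => j; rewrite -extE.
Qed.

(** Common points correspond to feasible points of the system, and a vanishing weight puts the point
    on a facet of one of the simplices; the claim becomes [orthant_parity]. *)
Lemma meet_parity :
  \big[addb/false]_(k < size s1) `[< meet (facet k s1) s2 >] (+)
  \big[addb/false]_(k < size s2) `[< meet s1 (facet k s2) >] = false.
Proof.
have of_weights k (s : seq 'rV[R]_d) w x : weights s w x -> k = size s ->
    exists a : 'rV[R]_k, weights s (ext a) x /\ forall i : 'I_k, a 0 i = w i.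
  move=> [w0 w1 ->] ->; exists (\row_i w i); split; last by move=> i; rewrite mxE.
  split; first by move=> i; apply: ext_ge0 => j; rewrite mxE.
    by rewrite -w1; apply: eq_bigr => i _; rewrite extE mxE.
  by apply: eq_bigr => i _; rewrite extE mxE.
have extF k (a : 'rV[R]_k) P : (forall i : 'I_k, ~~ P (val i) -> a 0 i = 0) ->
    forall i, (i < k)%N -> ~~ P i -> ext a i = 0.
  by move=> aP i ik Pi; rewrite (extE a (Ordinal ik)) aP.
rewrite -[RHS](@orthant_parity R (m + n) (d + (1 + 1)) A c); last first.
(* Two vanishing weights would make subsequences with two points fewer meet, against
   transversality. *)
- move=> z; rewrite -(hsubmxK z).
  set a := lsubmx z; set b := rsubmx z => /feasibleP[x [wa wb]] i j zi zj.
  apply/eqP; apply: contrapT => /negP ij.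
  pose P1 k := ext a k != 0; pose P2 k := ext b k != 0.
  apply: (transverse (t1 := sub_seq P1 s1) (t2 := sub_seq P2 s2)).
  + by move=> p /mapP[k]; rewrite mem_filter mem_iota => /andP[_ /= ks ->]; rewrite mem_nth.
  + by move=> p /mapP[k]; rewrite mem_filter mem_iota => /andP[_ /= ks ->]; rewrite mem_nth.
  + have cnt k (e : 'rV[R]_k) : size [seq l <- iota 0 k | ext e l != 0] =
        (\sum_(l < k) ((e 0 l != 0)%R : nat))%N.
      rewrite size_filter -sum1_count big_mkcond /=.
      transitivity (\sum_(l < k) ((ext e l != 0)%R : nat))%N.
        by rewrite -(big_mkord xpredT (fun l => (ext e l != 0)%R : nat)) /index_iota subn0;
          apply: eq_bigr => l _; case: eqP.
      by apply: eq_bigr => l _; rewrite extE.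
    rewrite !size_map !cnt.
    have -> : (\sum_(l < size s1) ((a 0 l != 0)%R : nat) + \sum_(l < size s2) ((b 0 l != 0)%R : nat) =
       \sum_(l < m + n) ((row_mx a b 0 l != 0)%R : nat))%N.
      rewrite big_split_ord /=; congr addn.
        by apply: eq_bigr => l _; rewrite row_mxEl.
      by apply: eq_bigr => l _; rewrite row_mxEr.
    rewrite (bigD1 i) //= (bigD1 j) //=; last by rewrite eq_sym.
    rewrite zi zj eqxx !add0n -/m -/n.
    apply: leq_trans (leq_sum _ (fun l _ => leq_b1 _)) _.
    rewrite sum1_card; have := cardD1 j (predC1 i).
    rewrite cardC1 card_ord !inE [j == i]eq_sym ij.
    set u := #|_|; set v := #|_|.
    have -> : u = v by apply: eq_card => l; rewrite !inE andbC.
    by rewrite /m /n; lia.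
  + exists x; split; apply/hull_sub_seqP; eexists; split; try eassumption.
      by move=> k _; rewrite negbK => /eqP.
    by move=> k _; rewrite negbK => /eqP.
(* A kernel vector has weights of sum 0 on each side, so without a negative entry it is zero. *)
- move=> y; rewrite -(hsubmxK y); set a := lsubmx y; set b := rsubmx y.
  rewrite mulA -[RHS]row_mx0 => /eq_row_mx[_]; rewrite -[RHS]row_mx0 => /eq_row_mx[].
  move=> /rowP/(_ 0) + /rowP/(_ 0); rewrite !mxE => a0 b0 ab0.
  apply: contrapT => nneg; case/eqP: ab0.
  have pos i : 0 <= row_mx a b 0 i by rewrite leNgt; apply/negP => h; apply: nneg; exists i.
  have az k (e : 'rV[R]_k) : (forall i, 0 <= e 0 i) -> \sum_i e 0 i = 0 -> e = 0.
    move=> e0 es; apply/rowP => i; rewrite mxE.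
    by move/eqP: es; rewrite psumr_eq0 // => /allP/(_ i (mem_index_enum i))/eqP.
  rewrite (az _ a) //; last by move=> i; have := pos (lshift n i); rewrite row_mxEl.
  by rewrite (az _ b) ?row_mx0 // => i; have := pos (rshift m i); rewrite row_mxEr.
- by rewrite /m /n; lia.
rewrite big_split_ord; congr addb; apply: eq_bigr => k _; congr asbool;
  apply/propext; split.
- move=> [x [/hull_sub_seqP[w [ws wk]] [w' ws']]].
  have [a [wa aE]] := of_weights m _ _ _ ws erefl.
  have [b [wb bE]] := of_weights n _ _ _ ws' erefl.
  exists (row_mx a b); split; last by rewrite row_mxEl aE wk //= eqxx.
  by apply/feasibleP; exists x.
- move=> [z []]; rewrite -(hsubmxK z); set a := lsubmx z; set b := rsubmx z.
  move=> /feasibleP[x [wa wb]]; rewrite row_mxEl => ak.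
  exists x; split; last by eexists; eassumption.
  apply/hull_sub_seqP; exists (ext a); split=> //.
  by apply: extF => i /=; rewrite negbK => /eqP/val_inj ->.
- move=> [x [[w ws] /hull_sub_seqP[w' [ws' wk]]]].
  have [a [wa aE]] := of_weights m _ _ _ ws erefl.
  have [b [wb bE]] := of_weights n _ _ _ ws' erefl.
  exists (row_mx a b); split; last by rewrite row_mxEr bE wk //= eqxx.
  by apply/feasibleP; exists x.
- move=> [z []]; rewrite -(hsubmxK z); set a := lsubmx z; set b := rsubmx z.
  move=> /feasibleP[x [wa wb]]; rewrite row_mxEr => bk.
  exists x; split; first by eexists; eassumption.
  apply/hull_sub_seqP; exists (ext b); split=> //.
  by apply: extF => i /=; rewrite negbK => /eqP/val_inj ->.
Qed.

End MeetParity.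

(** * The cut cochains and their coboundaries *)

Section Intersections.
Variables (R : realType) (V : finType) (p : V -> 'rV[R]_3).
Local Notation pt := 'rV[R]_3.

Definition cut0 (x : pt) (a b c d : V) : bool :=
  `[< meet [:: x] [:: p a; p b; p c; p d] >].
Definition cut1 (x y : pt) (a b c : V) : bool :=
  `[< meet [:: x; y] [:: p a; p b; p c] >].
Definition cut2 (x y z : pt) (a b : V) : bool :=
  `[< meet [:: x; y; z] [:: p a; p b] >].
Definition cut3 (x y z w : pt) (a : V) : bool :=
  `[< meet [:: x; y; z; w] [:: p a] >].

Variable D : pt -> Prop.

(** Simplices of dimensions i and j have i + j + 2 vertices, so at most four vertices in all means i
    + j < 3: in generic position they are disjoint. *)
Definition transversal : Prop := forall (t : seq pt) (s : seq V),
  (forall x, x \in t -> D x) -> (size t + size s <= 4)%N -> ~ meet t (map p s).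

Hypothesis trD : transversal.

(** Six vertices in all mean dimensions of sum 4, so the two simplices intersect in a segment or not
    at all; the facets counted here hold its ends. *)
Lemma cut_parity (t : seq pt) (s : seq V) :
  (forall x, x \in t -> D x) -> (size t + size s = 6)%N ->
  \big[addb/false]_(k < size t) `[< meet (facet k t) (map p s) >] (+)
  \big[addb/false]_(k < size (map p s)) `[< meet t (facet k (map p s)) >] = false.
Proof.
move=> tD ts; apply: meet_parity; first by rewrite size_map ts.
move=> t1 t2 t1t t2s sz.
have [s' s'E] : exists s', t2 = map p s'.
  elim: t2 t2s {sz} => [_|q t2 IH qs]; first by exists [::].
  have /mapP[a _ qE] : q \in map p s by apply: qs; rewrite mem_head.
  have [|s' s'E] := IH; first by move=> u ut; apply: qs; rewrite inE ut orbT.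
  by exists (a :: s'); rewrite /= qE s'E.
rewrite s'E; apply: trD; first by move=> x /t1t; apply: tD.
by move: sz; rewrite s'E !size_map ts.
Qed.

Let asbool_meet (t t' s s' : seq pt) :
  t =i t' -> s =i s' -> `[< meet t s >] = `[< meet t' s' >].
Proof.
by move=> tt' ss'; congr asbool; apply/propext; split; apply: meet_subset => v;
  rewrite ?tt' ?ss'.
Qed.

Lemma cut0_alt x : D x -> alt4 (cut0 x).
Proof.
move=> Dx; split=> [a b c d|a b c d|a b c].
- apply: asbool_meet => // v; rewrite !inE.
  by case: (v == p b); case: (v == p c); rewrite ?orbT.
- apply: asbool_meet => // v; rewrite !inE.
  by case: (v == p c); case: (v == p d); rewrite ?orbT.
(* A repeated vertex leaves three points besides [x], four in all, so transversality applies. *)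
- apply/asboolP => h; apply: (trD (t := [:: x]) (s := [:: a; b; c])) => //.
    by move=> y; rewrite inE => /eqP ->.
  apply: meet_subset h => // v; rewrite !inE.
  by case: (v == p b).
Qed.

Lemma cut1_alt x y : D x -> D y -> alt3 (cut1 x y).
Proof.
move=> Dx Dy; split=> [a b c|a b c|a b].
- apply: asbool_meet => // v; rewrite !inE.
  by case: (v == p a); case: (v == p b).
- apply: asbool_meet => // v; rewrite !inE.
  by case: (v == p b); case: (v == p c); rewrite ?orbT.
- apply/asboolP => h; apply: (trD (t := [:: x; y]) (s := [:: a; b])) => //.
    by move=> u; rewrite !inE => /orP[] /eqP ->.
  apply: meet_subset h => // v; rewrite !inE.
  by case: (v == p a).
Qed.

Let meet_nil (s : seq pt) : `[< meet [::] s >] = false.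
Proof. by apply/asboolP => -[x [/hull_nil]]. Qed.

(** In this and the next three identities the facets of the simplex on [V] give the coboundary,
    those of the other simplex its boundary. A single point has only the empty facet, which meets
    nothing. *)
Lemma delta4_cut0 x a b c d e : D x -> delta4 (cut0 x) a b c d e = false.
Proof.
move=> Dx; have := @cut_parity [:: x] [:: a; b; c; d; e].
rewrite !big_ord_recl !big_ord0 /facet /sub_seq /= meet_nil /= => h.
rewrite /delta4 /cut0 -[RHS]h //; last by move=> y; rewrite inE => /eqP ->.
move: `[< _ >] `[< _ >] `[< _ >] `[< _ >] `[< _ >].
by do 5 case.
Qed.

Lemma delta3_cut1 x y a b c d : D x -> D y ->
  delta3 (cut1 x y) a b c d = cut0 x a b c d (+) cut0 y a b c d.
Proof.
move=> Dx Dy; have := @cut_parity [:: x; y] [:: a; b; c; d].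
rewrite !big_ord_recl !big_ord0 /facet /sub_seq /= => h.
apply: addb_eq0; rewrite addbC /delta3 /cut0 /cut1.
rewrite -[RHS]h //; last by move=> u; rewrite !inE => /orP[] /eqP ->.
move: `[< _ >] `[< _ >] `[< _ >] `[< _ >] `[< _ >] `[< _ >].
by do 6 case.
Qed.

Lemma delta2_cut2 x y z a b c : D x -> D y -> D z ->
  delta2 (cut2 x y z) a b c =
    cut1 x y a b c (+) cut1 x z a b c (+) cut1 y z a b c.
Proof.
move=> Dx Dy Dz; have := @cut_parity [:: x; y; z] [:: a; b; c].
rewrite !big_ord_recl !big_ord0 /facet /sub_seq /= => h.
apply: addb_eq0; rewrite addbC /delta2 /cut1 /cut2.
rewrite -[RHS]h //; last by move=> u; rewrite !inE => /or3P[] /eqP ->.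
move: `[< _ >] `[< _ >] `[< _ >] `[< _ >] `[< _ >] `[< _ >].
by do 6 case.
Qed.

Lemma delta1_cut3 x y z w a b : D x -> D y -> D z -> D w ->
  delta1 (cut3 x y z w) a b =
    cut2 y z w a b (+) cut2 x z w a b (+) cut2 x y w a b (+) cut2 x y z a b.
Proof.
move=> Dx Dy Dz Dw; have := @cut_parity [:: x; y; z; w] [:: a; b].
rewrite !big_ord_recl !big_ord0 /facet /sub_seq /= => h.
apply: addb_eq0; rewrite addbC /delta1 /cut2 /cut3.
rewrite -[RHS]h //; last by move=> u; rewrite !inE => /or4P[] /eqP ->.
move: `[< _ >] `[< _ >] `[< _ >] `[< _ >] `[< _ >] `[< _ >].
by do 6 case.
Qed.

End Intersections.

(** * Simplices meeting a small set *)

Section Closed.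
Local Open Scope classical_set_scope.
Local Open Scope ring_scope.
Variables (R : realType) (d : nat).

Lemma box_compact n (a b : R) :
  compact [set v : 'rV[R]_n | forall i, v ord0 i \in `[a, b] ].
Proof. by apply: (rV_compact (A := fun=> `[a, b]%classic)) => _; apply: segment_compact. Qed.

(** The hull is the continuous image of the compact simplex of weights. *)
Lemma hull_closed (s : seq 'rV[R]_d) : closed (hull s).
Proof.
pose f (w : 'rV[R]_(size s)) : 'rV[R]_d := \sum_i w ord0 i *: s`_i.
pose g (w : 'rV[R]_(size s)) : R := \sum_i w ord0 i.
have -> : hull s = f @` ([set w : 'rV[R]_(size s) | forall i, w ord0 i \in `[0, 1] ] `&` g @^-1` [set 1]).
  apply/seteqP; split=> x.
    move=> [w [w0 w1 ->]]; exists (\row_i w i); last first.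
      by apply: eq_bigr => i _; rewrite mxE.
    split=> /=; last by rewrite -w1; apply: eq_bigr => i _; rewrite mxE.
    move=> i; rewrite mxE in_itv /= w0 -w1 (bigD1 i) //= lerDl.
    by apply: sumr_ge0.
  move=> [w [w01 w1] <-].
  exists (fun i => if insub i is Some j then w ord0 j else 0); split.
  - move=> i; case: insubP => // j _ _; have := w01 j.
    by rewrite in_itv => /andP[].
  - by rewrite -w1; apply: eq_bigr => i _; rewrite valK.
  - by apply: eq_bigr => i _; rewrite valK.
apply: compact_closed; first exact: norm_hausdorff.
apply: continuous_compact.
  apply: continuous_subspaceT; apply: continuous_big => [|i _ w].
    exact: add_continuous.
  by apply: continuousZr_tmp; apply: coord_continuous.
apply: compact_closedI; first exact: box_compact.
apply: preimage_closed; last exact: closed_eq.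
move=> w _; apply: continuous_big => [|i _]; first exact: add_continuous.
exact: coord_continuous.
Qed.

Lemma nbhs_box (x : 'rV[R]_d) (A : set 'rV[R]_d) : nbhs x A ->
  exists2 e : R, 0 < e & forall y : 'rV[R]_d, (forall i, `|x ord0 i - y ord0 i| < e) -> A y.
Proof.
move=> /nbhs_ballP[e /= e0 eA]; exists e => // y xy; apply: eA; split=> // i j.
by rewrite ord1; apply: xy.
Qed.

Lemma box_nbhs (x : 'rV[R]_d) (e : R) : 0 < e ->
  nbhs x [set y : 'rV[R]_d | forall i, `|x ord0 i - y ord0 i| < e].
Proof.
by move=> e0; apply/nbhs_ballP; exists e => // y [_ xy] i; apply: xy.
Qed.

(* At a scale below the Lebesgue number, the C i seen from v have a common point. *)
Lemma lebesgue_point (I : finType) (C : I -> set 'rV[R]_d) (M : R) :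
  (forall i, closed (C i)) ->
  exists2 e : R, 0 < e & forall v : 'rV[R]_d, (forall i, `|v ord0 i| <= M) ->
    exists y, forall i (z : 'rV[R]_d), C i z -> (forall j, `|v ord0 j - z ord0 j| <= e) -> C i y.
Proof.
move=> Ccl.
pose P (k : nat) (v : 'rV[R]_d) := exists y, forall i (z : 'rV[R]_d), C i z ->
  (forall j, `|v ord0 j - z ord0 j| <= k.+1%:R^-1) -> C i y.
(* Compactness, with the filter at infinity, gives one [k] that works for the whole box. *)
have /compact_near_coveringP/(_ nat \oo P) := @box_compact d (- M) M.
case=> [x _|k _ kP]; last first.
  exists k.+1%:R^-1; first by rewrite invr_gt0.
  move=> v vM; apply: (kP k) => //= i.
  by rewrite in_itv /= -ler_norml.
(* A closed set that misses [x] stays at a positive distance from [x]. *)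
have sep i : exists2 e : R, 0 < e & ~ C i x ->
    forall z : 'rV[R]_d, (forall j, `|x ord0 j - z ord0 j| < e) -> ~ C i z.
  have [Cx|nCx] := pselect (C i x); first by exists 1.
  have := closed_openC (Ccl i); rewrite openE => /(_ x nCx)/nbhs_box[e e0 he].
  by exists e => // _ z /he.
pose e i := sval (cid2 (sep i)).
have e0 i : 0 < e i by rewrite /e; case: cid2.
have eP i : ~ C i x -> forall z : 'rV[R]_d, (forall j, `|x ord0 j - z ord0 j| < e i) -> ~ C i z.
  by rewrite /e; case: cid2.
pose em := \big[Num.min/1]_i e i.
have em0 : 0 < em by apply: lt_bigmin.
have em2 : 0 < em / 2 by rewrite divr_gt0.
have [k0 _ k0P] := near_infty_natSinv_lt (PosNum em2).
exists ([set y : 'rV[R]_d | forall i, `|x ord0 i - y ord0 i| < em / 2], [set k | (k0 <= k)%N]).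
  by split; [apply: box_nbhs|exists k0].
(* For [v] near [x] the common point is [x] itself: a set seen from [v] comes within [em] of [x], so
   it contains [x]. *)
move=> [v k] /= [xv k0k]; exists x => i z Ciz vz.
apply: contrapT => nCx; apply: (eP i nCx z _ Ciz) => j.
have emi : em <= e i by apply: bigmin_le.
have h1 := xv j; have h2 := vz j; have h3 := k0P k k0k; rewrite /= in h3.
apply: le_lt_trans (ler_distD (v ord0 j) _ _) _; apply: lt_le_trans emi.
by rewrite (splitr em) ltrD // (le_lt_trans h2).
Qed.

End Closed.

(** * Spanned simplices through a given point *)

Section Count.
Variables (R : realType) (V : finType) (p : V -> 'rV[R]_3).
Hypothesis p_inj : injective p.
Hypothesis gp : forall s : seq V, uniq s -> size s = 4%N ->
  forall (u : 'cV[R]_3) (b : R), u != 0 -> ~ (forall a, a \in s -> (p a *m u) 0 0 = b).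
Hypothesis V4 : (4 <= #|V|)%N.

Lemma orthogonal_to_two (v w : 'rV[R]_3) :
  exists u : 'cV[R]_3, [/\ u != 0, v *m u = 0 & w *m u = 0].
Proof.
have : kermx (col_mx v w)^T != 0.
  by rewrite -mxrank_eq0 mxrank_ker subn_eq0 -ltnNge (leq_ltn_trans (rank_leq_col _)).
move=> /rowV0Pn[u /sub_kermxP uA u0]; exists u^T; split.
- by rewrite -trmx_eq0 trmxK.
- by move: uA => /(congr1 trmx); rewrite trmx_mul trmxK trmx0 mul_col_mx -[0]vsubmxK
    => /eq_col_mx[-> _]; rewrite linear0.
- by move: uA => /(congr1 trmx); rewrite trmx_mul trmxK trmx0 mul_col_mx -[0]vsubmxK
    => /eq_col_mx[_ ->]; rewrite linear0.
Qed.

Lemma hull2 (q0 q1 y : 'rV[R]_3) : hull [:: q0; q1] y ->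
  exists l, y = q0 + l *: (q1 - q0).
Proof.
move=> [w [_]]; rewrite !big_ord_recl !big_ord0 /= !addr0 => w1 ->.
exists (w 1%N); have -> : w 0%N = 1 - w 1%N by rewrite -w1 addrK.
by rewrite scalerBl scale1r scalerBr addrAC addrA.
Qed.

Lemma hull3 (q0 q1 q2 y : 'rV[R]_3) : hull [:: q0; q1; q2] y ->
  exists l m, y = q0 + l *: (q1 - q0) + m *: (q2 - q0).
Proof.
move=> [w [_]]; rewrite !big_ord_recl !big_ord0 /= !addr0 => w1 ->.
exists (w 1%N), (w 2%N).
have -> : w 0%N = 1 - w 1%N - w 2%N by rewrite -w1 -addrA -opprD addrK.
apply/rowP => i; rewrite !mxE; ring.
Qed.

Lemma exists_notin (s : seq V) : (size s < #|V|)%N -> exists d, d \notin s.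
Proof.
move=> sV; apply/not_existsP => h.
have : (#|V| <= #|s|)%N 
    by apply: subset_leq_card; apply/fintype.subsetP => d _; apply: contrapT => /negP; apply: h.
by move=> /leq_trans/(_ (card_size s)); rewrite leqNgt sV.
Qed.

Variable y : 'rV[R]_3.

Definition on_line (a b : V) : Prop := exists l : R, y = p a + l *: (p b - p a).

(** The pairs that do not span a plane together with [y]. *)
Definition degenerate (a b : V) : bool := (a == b) || `[< on_line a b >].

Lemma cnt1_le1 (f : V -> bool) : (forall a b, f a -> f b -> a = b) -> (cnt1 f <= 1)%N.
Proof.
move=> f1; have [[a fa]|nf] := pselect (exists a, f a); last first.
  by rewrite /cnt1 big1 // => a _; case fa: (f a) => //; case: nf; exists a.
rewrite /cnt1 (bigD1 a) //= big1 ?addn0 ?leq_b1 // => b ba.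
by case fb: (f b) => //; rewrite (f1 _ _ fa fb) eqxx in ba.
Qed.

(** If [y] lies in the triangle but not on the line [a b], then [c] lies in the plane through [a],
    [b], [y]; two such points would give four coplanar points. *)
Lemma cnt1_triangles a b : ~~ degenerate a b ->
  (cnt1 (fun c => `[< hull [:: p a; p b; p c] y >]) <= 1)%N.
Proof.
rewrite negb_or => /andP[ab /asboolPn nline]; apply: cnt1_le1 => c c' /asboolP hc /asboolP hc'.
have [u [u0 bu yu]] := orthogonal_to_two (p b - p a) (y - p a).
have third e : hull [:: p a; p b; p e] y ->
    [/\ e != a, e != b & (p e *m u) 0 0 = (p a *m u) 0 0].
  move=> he; have ea : e != a.
    apply/eqP => ea; apply: nline; apply: hull2.
    by apply: hull_subset he => v; rewrite ea !inE; case: (v == p a); rewrite ?orbT ?orbF.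
  have eb : e != b.
    apply/eqP => eb; apply: nline; apply: hull2.
    by apply: hull_subset he => v; rewrite eb !inE; case: (v == p b); rewrite ?orbT ?orbF.
  split=> //; have [l [m yE]] := hull3 he.
  have m0 : m != 0.
    by apply/eqP => m0; apply: nline; exists l; rewrite yE m0 scale0r addr0.
  move: yu; rewrite yE addrC !addrA addNr add0r mulmxDl -!scalemxAl bu scaler0 add0r.
  move=> /eqP; rewrite scaler_eq0 (negPf m0) /= mulmxBl subr_eq0 => /eqP ->.
  by [].
have [ca cb cu] := third c hc; have [c'a c'b c'u] := third c' hc'.
apply/eqP; apply: contrapT => cc'; move/negP: cc' => cc'.
have bu' : (p b *m u) 0 0 = (p a *m u) 0 0.
  by move/eqP: bu; rewrite mulmxBl subr_eq0 => /eqP ->.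
apply: (@gp [:: a; b; c; c'] _ _ u ((p a *m u) 0 0) u0) => //.
  by rewrite /= !inE !negb_or ab (negPf cc') [a == c]eq_sym [a == c']eq_sym [b == c]eq_sym [b == c']eq_sym ca c'a cb c'b.
by move=> e; rewrite !inE => /or4P[] /eqP ->.
Qed.

(** Besides [a], the line through [a] and [y] holds at most one point: two of them and any fourth
    point would be coplanar with [a]. *)
Lemma cnt1_degenerate a : p a != y -> (cnt1 (degenerate a) <= 2)%N.
Proof.
move=> ya.
have le : (cnt1 (degenerate a) <=
    cnt1 (pred1 a) + cnt1 (fun b => (a != b) && degenerate a b))%N.
  rewrite -big_split; apply: leq_sum => b _ /=; rewrite [b == a]eq_sym.
  by case: (a == b); rewrite ?addn0 ?leq_b1 ?add0n.
apply: leq_trans le _; rewrite -[2%N]/(1 + 1)%N; apply: leq_add; apply: cnt1_le1.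
  by move=> b c /eqP -> /eqP ->.
have line b : (a != b) && degenerate a b -> a != b /\ exists l : R, p b - p a = l *: (y - p a).
  move=> /andP[ab]; rewrite /degenerate (negPf ab) => /asboolP[l yE]; split=> //.
  exists l^-1; rewrite yE [p a + _]addrC addrK scalerA mulVf ?scale1r //.
  by apply/eqP => l0; move: ya; rewrite yE l0 scale0r addr0 eqxx.
move=> b c /line[ab [l bE]] /line[ac [m cE]].
apply/eqP; apply: contrapT => bc; move/negP: bc => bc.
have [e] := @exists_notin [:: a; b; c] V4; rewrite !inE !negb_or => /and3P[ea eb ec].
have [u [u0 eu yu]] := orthogonal_to_two (p e - p a) (y - p a).
have sub0 q : (q - p a) *m u = 0 -> (q *m u) 0 0 = (p a *m u) 0 0.
  by move/eqP; rewrite mulmxBl subr_eq0 => /eqP ->.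
apply: (@gp [:: a; b; c; e] _ _ u ((p a *m u) 0 0) u0) => //.
  by rewrite /= !inE !negb_or ab ac (negPf bc) [a == e]eq_sym [b == e]eq_sym [c == e]eq_sym ea eb ec.
move=> x; rewrite !inE => /or4P[] /eqP -> //; apply: sub0 => //.
  by rewrite bE -scalemxAl yu scaler0.
by rewrite cE -scalemxAl yu scaler0.
Qed.

Lemma cnt2_degenerate : (cnt2 degenerate <= 3 * #|V|)%N.
Proof.
have sumn : (\sum_(b in V) 1 = #|V|)%N by rewrite sum1_card.
apply: (@leq_trans (\sum_a (2 + #|V| * (p a == y)))%N).
  apply: leq_sum => a _; have [ya|ya] := eqVneq (p a) y.
    apply: leq_trans (leq_addl _ _); rewrite muln1 -sumn.
    by apply: leq_sum => b _; apply: leq_b1.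
  by rewrite muln0 addn0; apply: cnt1_degenerate.
rewrite big_split /= sum_nat_const -big_distrr /=.
have : (cnt1 (fun a => p a == y) <= 1)%N.
  by apply: cnt1_le1 => a b /eqP <- /eqP /p_inj.
by move=> h; apply: leq_trans (leq_add (leqnn _) (leq_mul (leqnn _) h)) _; rewrite -mulnDr mulnC.
Qed.

(** A nondegenerate pair is completed in at most one way and a degenerate one in at most n, whence
    n^2 + 3 n^2. *)
Lemma cnt3_hull :
  (cnt3 (fun a b c => `[< hull [:: p a; p b; p c] y >]) <= 4 * #|V| ^ 2)%N.
Proof.
apply: (@leq_trans (\sum_(a in V) \sum_(b in V) (1 + #|V| * degenerate a b))%N).
  apply: leq_sum => a _; apply: leq_sum => b _.
  case: (boolP (degenerate a b)) => ab.
    apply: leq_trans (leq_addl _ _); rewrite muln1 -sum1_card.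
    by apply: leq_sum => c _; apply: leq_b1.
  by rewrite muln0 addn0; apply: cnt1_triangles.
under eq_bigr => a _ do rewrite big_split /= -big_distrr /= sum1_card.
rewrite big_split /= sum_nat_const -big_distrr /=.
by apply: leq_trans (leq_add (leqnn _) (leq_mul (leqnn _) cnt2_degenerate)) _; rewrite mulnCA -mulSn.
Qed.

Lemma cnt2_hull : (cnt2 (fun a b => `[< hull [:: p a; p b] y >]) <= 3 * #|V|)%N.
Proof.
apply: leq_trans cnt2_degenerate; apply: leq_sum => a _; apply: leq_sum => b _.
case: asboolP => // /hull2[l yE].
have -> : degenerate a b by apply/orP; right; apply/asboolP; exists l.
by [].
Qed.

Lemma cnt1_hull : (cnt1 (fun a => `[< hull [:: p a] y >]) <= 1)%N.
Proof.
have hull1 q : hull [:: q] y -> y = q.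
  move=> [w [_]]; rewrite !big_ord_recl !big_ord0 /= !addr0 => -> ->.
  by rewrite scale1r.
by apply: cnt1_le1 => a b /asboolP/hull1 ya /asboolP/hull1 yb; apply: p_inj; rewrite -ya.
Qed.

End Count.

(** * Generic translations of a grid *)

Section MomentCurve.
Variable R : realType.

Definition moment (t : R) : 'rV[R]_3 := \row_i t ^+ i.+1.

(** The equation of a plane, restricted to the moment curve. *)
Definition moment_poly (u : 'cV[R]_3) (b : R) : {poly R} :=
  \poly_(i < 4) (if i is j.+1 then u (inord j) 0 else - b).

Lemma moment_polyE u b t : (moment_poly u b).[t] = (moment t *m u) 0 0 - b.
Proof.
rewrite horner_poly big_ord_recl /= expr0 mulr1 addrC; congr (_ - _).
by rewrite mxE; apply: eq_bigr => i _; rewrite !mxE mulrC /= add0n inord_val.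
Qed.

Lemma moment_poly_neq0 u b : u != 0 -> moment_poly u b != 0.
Proof.
move=> u0; apply: contra u0 => /eqP/polyP q0; apply/eqP/colP => i.
have := q0 i.+1; rewrite coef0 coef_poly ltnS ltn_ord /= inord_val => ->.
by rewrite mxE.
Qed.

Lemma exists_nonroot (Q : {poly R}) : Q != 0 ->
  exists t, [/\ 0 < t, t <= 1 & Q.[t] != 0].
Proof.
(* There are more candidates 1/(k+1) than [Q] has roots. *)
move=> Q0; pose s := [seq (k.+1%:R^-1 : R) | k <- iota 0 (size Q)].
have us : uniq s.
  rewrite map_inj_uniq ?iota_uniq // => i j /invr_inj /eqP.
  by rewrite eqr_nat => /eqP[].
have : ~~ all (root Q) s.
  apply/negP => h; have := max_poly_roots Q0 h us.
  by rewrite size_map size_iota ltnn.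
move=> /allPn[t /mapP[k _ ->] nr]; exists k.+1%:R^-1; split; last exact: nr.
  by rewrite invr_gt0.
by rewrite invf_le1 ?ler1n.
Qed.

Lemma avoid_planes (I : finType) (u : I -> 'cV[R]_3) (b : I -> R) :
  (forall i, u i != 0) ->
  exists t, [/\ 0 < t, t <= 1 & forall i, (moment t *m u i) 0 0 != b i].
Proof.
move=> u0; have [|t [t0 t1 ht]] := @exists_nonroot (\prod_i moment_poly (u i) (b i)).
  by apply/prodf_neq0 => i _; apply: moment_poly_neq0.
exists t; split=> // i; apply: contra ht => /eqP h.
by rewrite horner_prod (bigD1 i) //= moment_polyE h subrr mul0r.
Qed.

Lemma hull_hyperplane (s : seq 'rV[R]_3) (u : 'cV[R]_3) (c : R) z :
  (forall v, v \in s -> (v *m u) 0 0 = c) -> hull s z -> (z *m u) 0 0 = c.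
Proof.
move=> sc [w [_ w1 ->]]; rewrite mulmx_suml summxE -[RHS]mul1r -w1 mulr_suml.
by apply: eq_bigr => i _; rewrite -scalemxAl mxE sc // mem_nth.
Qed.

Variables (V G : finType) (p : V -> 'rV[R]_3) (g : G -> 'rV[R]_3).

(** If the simplices meet, [x + g i - p a] is a combination of edge vectors from [g i] and from
    [p a]. With at most four vertices in all there are at most two such vectors, which confines [x]
    to a plane. *)
Lemma bad_shifts (l : seq G) (s : seq V) : (size l + size s <= 4)%N ->
  exists ub : 'cV[R]_3 * R, ub.1 != 0 /\
    forall x, meet [seq x + g i | i <- l] (map p s) -> (x *m ub.1) 0 0 = ub.2.
Proof.
have c1 : (const_mx 1 : 'cV[R]_3) != 0.
  by apply/eqP => /colP/(_ 0); rewrite !mxE => /eqP; rewrite oner_eq0.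
case: l => [|i l]; first by move=> _; exists (const_mx 1, 0); split=> // x [y [/hull_nil]].
case: s => [|a s]; first by move=> _; exists (const_mx 1, 0); split=> // x [y [_ /hull_nil]].
move=> sz; pose dirs := [seq g j - g i | j <- l] ++ [seq p c - p a | c <- s].
have [u [u0 uP]] : exists u : 'cV[R]_3, u != 0 /\ forall v, v \in dirs -> v *m u = 0.
  have [u [u0 u1 u2]] := orthogonal_to_two (nth 0 dirs 0) (nth 0 dirs 1).
  have szd : (size dirs <= 2)%N by move: sz; rewrite size_cat !size_map /=; lia.
  exists u; split=> // v; case: dirs szd u1 u2 => [|v1 [|v2 []]] //= _ h1 h2.
    by rewrite inE => /eqP ->.
  by rewrite !inE => /orP[] /eqP ->.
exists (u, (p a *m u) 0 0 - (g i *m u) 0 0); split=> //= x [z [zx zp]].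
have /hull_hyperplane/(_ zx) zE : forall v, v \in [seq x + g j | j <- i :: l] ->
    (v *m u) 0 0 = (x *m u) 0 0 + (g i *m u) 0 0.
  move=> v /mapP[j]; rewrite inE => jl ->; rewrite mulmxDl mxE; congr (_ + _).
  case/orP: jl => [/eqP -> //|jl]; have := uP (g j - g i).
  rewrite mem_cat (map_f (fun j => g j - g i) jl) mulmxBl => /(_ isT)/eqP; rewrite subr_eq0 => /eqP ->.
  by [].
have /hull_hyperplane/(_ zp) : forall v, v \in map p (a :: s) ->
    (v *m u) 0 0 = (p a *m u) 0 0.
  move=> v /mapP[c]; rewrite inE => cs ->.
  case/orP: cs => [/eqP -> //|cs]; have := uP (p c - p a).
  rewrite mem_cat (map_f (fun c => p c - p a) cs) orbT mulmxBl => /(_ isT)/eqP; rewrite subr_eq0 => /eqP ->.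
  by [].
by rewrite zE => <-; rewrite addrK.
Qed.

(* The moment curve is not contained in a union of finitely many planes. *)
Lemma transversal_shift : exists t : R, [/\ 0 < t, t <= 1
  & transversal p (fun v => exists i, v = moment t + g i)].
Proof.
(* Sequences of length at most 4 form a finite type, so finitely many planes are to be avoided; a
   pair with too many entries receives an arbitrary plane. *)
pose P (ls : 4.-bseq G * 4.-bseq V) (ub : 'cV[R]_3 * R) := ub.1 != 0 /\
  ((size ls.1 + size ls.2 <= 4)%N -> forall x,
    meet [seq x + g i | i <- ls.1] (map p ls.2) -> (x *m ub.1) 0 0 = ub.2).
have /exists_choice[ub ubP] : forall ls, exists ub, P ls ub.
  move=> ls; have [sz|sz] := boolP (size ls.1 + size ls.2 <= 4)%N.
    by have [ub [h1 h2]] := bad_shifts sz; exists ub; split.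
  exists (const_mx 1, 0); split=> //=; last by move=> h; rewrite h in sz.
  by apply/eqP => /colP/(_ 0); rewrite !mxE => /eqP; rewrite oner_eq0.
have [|t [t0 t1 tP]] := @avoid_planes _ (fun ls => (ub ls).1) (fun ls => (ub ls).2).
  by move=> ls; have [] := ubP ls.
exists t; split=> // l s lD sz h.
have [l' l'E] : exists l', l = [seq moment t + g i | i <- l'].
  elim: l lD {sz h} => [|v l IH] lD; first by exists [::].
  have [|l' ->] := IH; first by move=> x xl; apply: lD; rewrite inE xl orbT.
  by have [i ->] := lD v (mem_head _ _); exists (i :: l').
have szl' : (size l' <= 4)%N by move: sz; rewrite l'E size_map; lia.
have szs : (size s <= 4)%N by move: sz; lia.
rewrite l'E in h; have [_] := ubP (Bseq szl', Bseq szs).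
have sz' : (size l' + size s <= 4)%N by move: sz; rewrite l'E size_map.
by move=> /(_ sz' _ h)/eqP; apply/negP; apply: tP.
Qed.

End MomentCurve.

(** * The Kuhn triangulation *)

Section Telescope.
Variable N : nat.
Implicit Types f g : nat -> nat -> nat -> bool.

Definition box_sum f : bool :=
  \big[addb/false]_(i < N) \big[addb/false]_(j < N) \big[addb/false]_(k < N) f i j k.

Lemma box_sumD f g :
  box_sum (fun i j k => f i j k (+) g i j k) = box_sum f (+) box_sum g.
Proof. by rewrite /box_sum; do 2 (rewrite -big_split; apply: eq_bigr => ? _); rewrite -big_split. Qed.

Lemma telescope_addb (h : nat -> bool) :
  \big[addb/false]_(i < N) (h i (+) h i.+1) = h 0%N (+) h N.
Proof.
elim: N => [|n IH]; first by rewrite big_ord0 addbb.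
by rewrite big_ord_recr IH /= -addbA (addbA (h n)) addbb.
Qed.

Lemma box_sum_telescope1 f :
  (forall j k, (j < N)%N -> (k < N)%N -> f 0%N j k = false /\ f N j k = false) ->
  box_sum (fun i j k => f i j k (+) f i.+1 j k) = false.
Proof.
move=> f0; pose h i := \big[addb/false]_(j < N) \big[addb/false]_(k < N) f i j k.
rewrite /box_sum (eq_bigr (fun i : 'I_N => h i (+) h i.+1)) ?telescope_addb /h.
  by rewrite !big1 // => j _; rewrite big1 // => k _; case: (f0 j k).
by move=> i _; rewrite -big_split; apply: eq_bigr => j _; rewrite -big_split.
Qed.

Lemma box_sum_telescope2 f :
  (forall i k, (i < N)%N -> (k < N)%N -> f i 0%N k = false /\ f i N k = false) ->
  box_sum (fun i j k => f i j k (+) f i j.+1 k) = false.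
Proof.
move=> f0; rewrite /box_sum big1 // => i _.
pose h j := \big[addb/false]_(k < N) f i j k.
rewrite (eq_bigr (fun j : 'I_N => h j (+) h j.+1)) ?telescope_addb /h.
  by rewrite !big1 // => k _; case: (f0 i k).
by move=> j _; rewrite -big_split.
Qed.

Lemma box_sum_telescope3 f :
  (forall i j, (i < N)%N -> (j < N)%N -> f i j 0%N = false /\ f i j N = false) ->
  box_sum (fun i j k => f i j k (+) f i j k.+1) = false.
Proof.
move=> f0; rewrite /box_sum big1 // => i _; rewrite big1 // => j _.
by rewrite telescope_addb; case: (f0 i j) => // -> ->.
Qed.

Variables (X : Type) (c : nat -> nat -> nat -> X).

(* One simplex of the Kuhn triangulation of the cube for each order of the
   coordinate directions. *)
Definition cell_sum (T : X -> X -> X -> X -> bool) (i j k : nat) : bool :=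
  T (c i j k) (c i.+1 j k) (c i.+1 j.+1 k) (c i.+1 j.+1 k.+1) (+)
  T (c i j k) (c i.+1 j k) (c i.+1 j k.+1) (c i.+1 j.+1 k.+1) (+)
  T (c i j k) (c i j.+1 k) (c i.+1 j.+1 k) (c i.+1 j.+1 k.+1) (+)
  T (c i j k) (c i j.+1 k) (c i j.+1 k.+1) (c i.+1 j.+1 k.+1) (+)
  T (c i j k) (c i j k.+1) (c i.+1 j k.+1) (c i.+1 j.+1 k.+1) (+)
  T (c i j k) (c i j k.+1) (c i j.+1 k.+1) (c i.+1 j.+1 k.+1).

(** A triangle through the main diagonal of a cube belongs to two of its tetrahedra and cancels
    there. Any other lies in a side of the cube and cancels against the next cube, or vanishes on
    the boundary of the box. *)
Lemma box_sum_faces (K : X -> X -> X -> bool) :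
  (forall i j k, (i < N)%N -> (j < N)%N -> k = 0%N \/ k = N ->
     K (c i j k) (c i.+1 j k) (c i.+1 j.+1 k) = false /\
     K (c i j k) (c i j.+1 k) (c i.+1 j.+1 k) = false) ->
  (forall i j k, (i < N)%N -> (k < N)%N -> j = 0%N \/ j = N ->
     K (c i j k) (c i.+1 j k) (c i.+1 j k.+1) = false /\
     K (c i j k) (c i j k.+1) (c i.+1 j k.+1) = false) ->
  (forall i j k, (j < N)%N -> (k < N)%N -> i = 0%N \/ i = N ->
     K (c i j k) (c i j.+1 k) (c i j.+1 k.+1) = false /\
     K (c i j k) (c i j k.+1) (c i j.+1 k.+1) = false) ->
  box_sum (cell_sum (fun x y z w => K y z w (+) K x z w (+) K x y w (+) K x y z))
    = false.
Proof.
move=> K3 K2 K1.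
(* [A12] is the triangle of a step in direction 1 followed by one in direction 2; it telescopes
   along direction 3. The others are alike. *)
pose A12 i j k := K (c i j k) (c i.+1 j k) (c i.+1 j.+1 k).
pose A21 i j k := K (c i j k) (c i j.+1 k) (c i.+1 j.+1 k).
pose A13 i j k := K (c i j k) (c i.+1 j k) (c i.+1 j k.+1).
pose A31 i j k := K (c i j k) (c i j k.+1) (c i.+1 j k.+1).
pose A23 i j k := K (c i j k) (c i j.+1 k) (c i j.+1 k.+1).
pose A32 i j k := K (c i j k) (c i j k.+1) (c i j.+1 k.+1).
have -> : cell_sum (fun x y z w => K y z w (+) K x z w (+) K x y w (+) K x y z) =
  (fun i j k => (A12 i j k (+) A12 i j k.+1) (+) (A21 i j k (+) A21 i j k.+1) (+)
    (A13 i j k (+) A13 i j.+1 k) (+) (A31 i j k (+) A31 i j.+1 k) (+)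
    (A23 i j k (+) A23 i.+1 j k) (+) (A32 i j k (+) A32 i.+1 j k)).
  apply/funext => i; apply/funext => j; apply/funext => k.
  rewrite /cell_sum.
  rewrite [LHS](AC (4*4*4*4*4*4) ((3*7)*(11*15)*(19*23)*(2*10)*(6*18)*(14*22)
    *((4*17)*(12*21)*(8*9)*(16*1)*(20*13)*(24*5))))/= !addbb.
  by rewrite /A12 /A21 /A13 /A31 /A23 /A32 /= [LHS](AC ((2*2*2*2*2*2)) ((1*2)*(3*4)*(5*6)*(9*10)*(7*8)*(11*12))).
rewrite 5!box_sumD.
rewrite !box_sum_telescope3 ?box_sum_telescope2 ?box_sum_telescope1 //.
all: move=> i j iN jN.
- by have [] := K1 0%N i j iN jN (or_introl erefl); have [] := K1 N i j iN jN (or_intror erefl).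
- by have [] := K1 0%N i j iN jN (or_introl erefl); have [] := K1 N i j iN jN (or_intror erefl).
- by have [] := K2 i 0%N j iN jN (or_introl erefl); have [] := K2 i N j iN jN (or_intror erefl).
- by have [] := K2 i 0%N j iN jN (or_introl erefl); have [] := K2 i N j iN jN (or_intror erefl).
- by have [] := K3 i j 0%N iN jN (or_introl erefl); have [] := K3 i j N iN jN (or_intror erefl).
- by have [] := K3 i j 0%N iN jN (or_introl erefl); have [] := K3 i j N iN jN (or_intror erefl).
Qed.

End Telescope.

Lemma perm_eq3 (I : eqType) (x y z : I) : let s := [:: x; y; z] in
  [/\ perm_eq [:: x; z; y] s, perm_eq [:: y; x; z] s, perm_eq [:: y; z; x] s
    & perm_eq [:: z; x; y] s /\ perm_eq [:: z; y; x] s].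
Proof.
have yxz : perm_eq [:: y; x; z] [:: x; y; z].
  by rewrite (perm_cat2r [:: z] [:: y; x] [:: x; y]) (perm_catC [:: y] [:: x]).
split=> //; last split.
- by rewrite (perm_cat2l [:: x] [:: z; y]) (perm_catC [:: z] [:: y]).
- by rewrite (perm_catC [:: y; z] [:: x]).
- by rewrite (perm_catC [:: z] [:: x; y]).
- by rewrite (perm_trans _ yxz) // (perm_catC [:: z] [:: y; x]).
Qed.

(** [P] lies between the weak and the strict decreasing order of the values of [f]. This rules out
    ties, so exactly one of the six orders satisfies [P]. *)
Lemma one_order (R : realType) (I : eqType) (f : I -> R) (x y z : I)
    (P : I -> I -> I -> Prop) :
  (forall a b c, perm_eq [:: a; b; c] [:: x; y; z] ->
    0 <= f c -> f c <= f b -> f b <= f a -> f a <= 1 -> P a b c) ->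
  (forall a b c, perm_eq [:: a; b; c] [:: x; y; z] ->
    P a b c -> f c < f b /\ f b < f a) ->
  0 <= f x <= 1 -> 0 <= f y <= 1 -> 0 <= f z <= 1 ->
  `[< P x y z >] (+) `[< P x z y >] (+) `[< P y x z >] (+) `[< P y z x >] (+)
  `[< P z x y >] (+) `[< P z y x >] = true.
Proof.
move=> Pge Plt /andP[x0 x1] /andP[y0 y1] /andP[z0 z1].
have pE a b c : perm_eq [:: a; b; c] [:: x; y; z] -> 0 <= f c -> f a <= 1 ->
    `[< P a b c >] = (f c <= f b) && (f b <= f a).
  move=> abc c0 a1; apply/asboolP/andP => [/(Plt _ _ _ abc)[/ltW ? /ltW ?]//|[? ?]].
  exact: Pge.
have tie a b c : perm_eq [:: a; b; c] [:: x; y; z] -> f a != f b.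
  move=> abc; apply/eqP => ab.
  have r01 t : t \in [:: a; b; c] -> 0 <= f t /\ f t <= 1.
    by rewrite (perm_mem abc) !inE => /or3P[] /eqP ->.
  have [a0 a1] : 0 <= f a /\ f a <= 1 by apply: r01; rewrite !inE eqxx.
  have [b0 b1] : 0 <= f b /\ f b <= 1 by apply: r01; rewrite !inE eqxx orbT.
  have [c0 c1] : 0 <= f c /\ f c <= 1 by apply: r01; rewrite !inE eqxx !orbT.
  have [cb|/ltW bc] := leP (f c) (f b).
    have ba : f b <= f a by rewrite ab.
    by have /(Plt _ _ _ abc)[_] := Pge _ _ _ abc c0 cb ba a1; rewrite ab ltxx.
  have cab : perm_eq [:: c; a; b] [:: x; y; z].
    by rewrite (perm_trans _ abc) // (perm_catC [:: c] [:: a; b]).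
  have ba : f b <= f a by rewrite ab.
  have ac : f a <= f c by rewrite ab.
  by have /(Plt _ _ _ cab)[] := Pge _ _ _ cab b0 ba ac c1; rewrite ab ltxx.
have p1 := perm_refl [:: x; y; z]; have [p2 p3 p4 [p5 p6]] := perm_eq3 x y z.
rewrite !pE //; move: (tie _ _ _ p1) (tie _ _ _ p2) (tie _ _ _ p4).
case: (ltgtP (f x) (f y)) => // xy; case: (ltgtP (f x) (f z)) => // xz.
all: case: (ltgtP (f y) (f z)) => // yz _ _ _.
all: by have := lt_trans xy yz; rewrite ltNge (ltW xz).
Qed.

(** * Locating a point in the triangulated grid *)

Section Cell.
Variables (R : realType) (h : R) (q : 'rV[R]_3).
Hypothesis h0 : 0 < h.

Definition step (a : 'I_3) : 'rV[R]_3 := h *: delta_mx 0 a.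

Definition kuhn_simplex (v : 'rV[R]_3) (a b c : 'I_3) : seq 'rV[R]_3 :=
  [:: v; v + step a; v + step a + step b; v + step a + step b + step c].

Definition local_coord (v : 'rV[R]_3) (i : 'I_3) : R := (q 0 i - v 0 i) / h.

Lemma weights_kuhn_simplex v a b c w : weights (kuhn_simplex v a b c) w q ->
  [/\ forall i, 0 <= w i, w 0%N + w 1%N + w 2%N + w 3%N = 1 &
  forall i, local_coord v i = (w 1%N + w 2%N + w 3%N) * (i == a)%:R +
    (w 2%N + w 3%N) * (i == b)%:R + w 3%N * (i == c)%:R].
Proof.
move=> [w0]; rewrite !big_ord_recl !big_ord0 /= !addr0 => w1 qE.
split=> //; first by rewrite -w1 !addrA.
move=> i; have -> : local_coord v i = (q 0 i - v 0 i) / h by [].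
apply: (mulIf (lt0r_neq0 h0)); rewrite divfK ?lt0r_neq0 // qE !mxE /=.
rewrite (_ : v 0 i = v 0 i * (w 0%N + (w 1%N + (w 2%N + w 3%N)))); last by rewrite w1 mulr1.
rewrite -[_ 0 i * _]mulrC; move: (v 0 i) (i == a)%:R (i == b)%:R (i == c)%:R => x da db dc.
have w0E : w 0%N = 1 - w 1%N - w 2%N - w 3%N by rewrite -w1; ring.
rewrite w0E; ring.
Qed.

Lemma kuhn_simplex_hull v (a b c : 'I_3) : uniq [:: a; b; c] ->
  0 <= local_coord v c -> local_coord v c <= local_coord v b ->
  local_coord v b <= local_coord v a -> local_coord v a <= 1 ->
  hull (kuhn_simplex v a b c) q.
Proof.
move=> abc c0 cb ba a1; set f := local_coord v.
(* The gaps in the chain [1 >= f a >= f b >= f c >= 0] are the barycentric coordinates. *)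
exists (fun i => nth 0 [:: 1 - f a; f a - f b; f b - f c; f c] i); split.
- move=> [|[|[|[|i]]]] /=; rewrite ?subr_ge0 //.
  by rewrite nth_nil.
- by rewrite !big_ord_recl !big_ord0 /= addr0; ring.
- rewrite !big_ord_recl !big_ord0 /= addr0; apply/rowP => i.
  have qE j : q 0 j = v 0 j + h * f j.
    by rewrite /f /local_coord mulrC divfK ?lt0r_neq0 // addrC subrK.
  rewrite qE !mxE /=.
  have : i \in [:: a; b; c].
    apply: contraT => ni; have : uniq (i :: [:: a; b; c]) by rewrite cons_uniq ni.
    move=> /uniq_leq_size/(_ (fun x _ => mem_enum 'I_3 x)).
    by rewrite size_enum_ord.
  move: abc; rewrite /= !inE !negb_or andbT => /andP[/andP[ab ac] bc].
  case/or3P => /eqP ->; rewrite ?eqxx ?(negPf ab) ?(negPf ac) ?(negPf bc)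
    ?[b == a]eq_sym ?[c == a]eq_sym ?[c == b]eq_sym ?(negPf ab) ?(negPf ac) ?(negPf bc) /=; ring.
Qed.

Lemma kuhn_simplex_strict v (a b c : 'I_3) : uniq [:: a; b; c] ->
  (forall k, (k < 4)%N -> ~ hull (facet k (kuhn_simplex v a b c)) q) ->
  hull (kuhn_simplex v a b c) q ->
  [/\ 0 < local_coord v c, local_coord v c < local_coord v b,
      local_coord v b < local_coord v a & local_coord v a < 1].
Proof.
move=> abc nf [w wq]; have [w0 w1 fE] := weights_kuhn_simplex wq.
have wpos k : (k < 4)%N -> 0 < w k.
  move=> k4; rewrite lt0r w0 andbT; apply/eqP => wk; apply: (nf k k4).
  apply/hull_sub_seqP; exists w; split=> // i _ /=; rewrite negbK => /eqP ->.
  exact: wk.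
move: abc; rewrite /= !inE !negb_or andbT => /andP[/andP[ab ac] bc].
rewrite !fE !eqxx ?(negPf ab) ?(negPf ac) ?(negPf bc) ?[b == a]eq_sym ?[c == a]eq_sym
  ?[c == b]eq_sym ?(negPf ab) ?(negPf ac) ?(negPf bc) /= !mulr1 !mulr0 !addr0 !add0r.
have := wpos 0%N isT; have := wpos 1%N isT; have := wpos 2%N isT; have := wpos 3%N isT.
by move=> h3 h2 h1 h00; split; lra.
Qed.

Variable x0 : 'rV[R]_3.

Definition grid (i j k : nat) : 'rV[R]_3 :=
  x0 + h *: (i%:R *: delta_mx 0 ord0 + j%:R *: delta_mx 0 (inord 1)
             + k%:R *: delta_mx 0 (inord 2)).

Let e1 : 'I_3 := ord0.
Let e2 : 'I_3 := inord 1.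
Let e3 : 'I_3 := inord 2.

Lemma gridS1 i j k : grid i.+1 j k = grid i j k + step e1.
Proof. by apply/rowP => l; rewrite !mxE -natr1 /e1; ring. Qed.
Lemma gridS2 i j k : grid i j.+1 k = grid i j k + step e2.
Proof. by apply/rowP => l; rewrite !mxE -natr1 /e2; ring. Qed.
Lemma gridS3 i j k : grid i j k.+1 = grid i j k + step e3.
Proof. by apply/rowP => l; rewrite !mxE -natr1 /e3; ring. Qed.

Lemma grid_coord1 i j k : grid i j k 0 e1 = x0 0 e1 + h * i%:R.
Proof.
rewrite !mxE /e1 /= -!val_eqE /= !inordK //=; ring.
Qed.
Lemma grid_coord2 i j k : grid i j k 0 e2 = x0 0 e2 + h * j%:R.
Proof.
rewrite !mxE /e2 /= -!val_eqE /= !inordK //=; ring.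
Qed.
Lemma grid_coord3 i j k : grid i j k 0 e3 = x0 0 e3 + h * k%:R.
Proof.
rewrite !mxE /e3 /= -!val_eqE /= !inordK //=; ring.
Qed.

Let T (x y z w : 'rV[R]_3) : bool := `[< hull [:: x; y; z; w] q >].

Lemma cell_sumE i j k : cell_sum grid T i j k =
  let v := grid i j k in
  `[< hull (kuhn_simplex v e1 e2 e3) q >] (+) `[< hull (kuhn_simplex v e1 e3 e2) q >] (+)
  `[< hull (kuhn_simplex v e2 e1 e3) q >] (+) `[< hull (kuhn_simplex v e2 e3 e1) q >] (+)
  `[< hull (kuhn_simplex v e3 e1 e2) q >] (+) `[< hull (kuhn_simplex v e3 e2 e1) q >].
Proof.
rewrite /cell_sum /T /kuhn_simplex /=.
have g12 : grid i.+1 j.+1 k = grid i j k + step e1 + step e2 by rewrite gridS2 gridS1.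
have g21 : grid i.+1 j.+1 k = grid i j k + step e2 + step e1 by rewrite gridS1 gridS2.
have g13 : grid i.+1 j k.+1 = grid i j k + step e1 + step e3 by rewrite gridS3 gridS1.
have g31 : grid i.+1 j k.+1 = grid i j k + step e3 + step e1 by rewrite gridS1 gridS3.
have g23 : grid i j.+1 k.+1 = grid i j k + step e2 + step e3 by rewrite gridS3 gridS2.
have g32 : grid i j.+1 k.+1 = grid i j k + step e3 + step e2 by rewrite gridS2 gridS3.
congr (_ (+) _ (+) _ (+) _ (+) _ (+) _); rewrite ?(gridS1 i j k) ?(gridS2 i j k) ?(gridS3 i j k).
- by rewrite gridS3 g12.
- by rewrite gridS2 g13.
- by rewrite gridS3 g21.
- by rewrite gridS1 g23.
- by rewrite gridS2 g31.
- by rewrite gridS1 g32.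
Qed.

Variable N : nat.
Hypothesis q_in : forall i, 0 < q 0 i - x0 0 i < h * N%:R.
Hypothesis generic : forall i j k (a b c : 'I_3) m, (i < N)%N -> (j < N)%N -> (k < N)%N ->
  uniq [:: a; b; c] -> (m < 4)%N -> ~ hull (facet m (kuhn_simplex (grid i j k) a b c)) q.

(** Only the cube given by the integer parts of the scaled coordinates of [q] contributes, and in it
    exactly one order of the directions, by [one_order]. *)
Lemma box_sum_containing : box_sum N (cell_sum grid T) = true.
Proof.
pose u i := (q 0 i - x0 0 i) / h.
have u0 i : 0 <= u i by have /andP[/ltW h1 _] := q_in i; rewrite divr_ge0 // ltW.
pose n i := Num.truncn (u i).
have nN i : (n i < N)%N.
  rewrite truncn_lt_nat // ltr_pdivrMr // mulrC.
  by have /andP[] := q_in i.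
have ue : uniq [:: e1; e2; e3] by rewrite /= !inE -!val_eqE /= !inordK.
have lc1 i j k : local_coord (grid i j k) e1 = u e1 - i%:R.
  by rewrite /local_coord grid_coord1 opprD addrA mulrBl mulrAC divff ?mul1r ?lt0r_neq0.
have lc2 i j k : local_coord (grid i j k) e2 = u e2 - j%:R.
  by rewrite /local_coord grid_coord2 opprD addrA mulrBl mulrAC divff ?mul1r ?lt0r_neq0.
have lc3 i j k : local_coord (grid i j k) e3 = u e3 - k%:R.
  by rewrite /local_coord grid_coord3 opprD addrA mulrBl mulrAC divff ?mul1r ?lt0r_neq0.
have S i j k (iN : (i < N)%N) (jN : (j < N)%N) (kN : (k < N)%N) a b c
    (abc : uniq [:: a; b; c]) :=
  @kuhn_simplex_strict (grid i j k) a b c abc (fun m m4 => generic iN jN kN abc m4).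
have cellE i j k : (i < N)%N -> (j < N)%N -> (k < N)%N ->
    cell_sum grid T i j k = [&& i == n e1, j == n e2 & k == n e3].
  move=> iN jN kN; rewrite cell_sumE /=.
  have [ijk|nijk] := boolP [&& i == n e1, j == n e2 & k == n e3]; last first.
    have no a b c : perm_eq [:: a; b; c] [:: e1; e2; e3] ->
        `[< hull (kuhn_simplex (grid i j k) a b c) q >] = false.
      move=> perm; have abc : uniq [:: a; b; c] by rewrite (perm_uniq perm).
      apply/asboolP => hq; move: nijk; apply/negP; rewrite negbK.
      have [c0 cb ba a1] := S i j k iN jN kN a b c abc hq.
      have all01 x : x \in [:: e1; e2; e3] -> 0 < local_coord (grid i j k) x < 1.
        rewrite -(perm_mem perm) !inE => /or3P[] /eqP ->.
        - by rewrite a1 (lt_trans c0) // (lt_trans cb).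
        - by rewrite (lt_trans c0) // (lt_trans ba).
        - by rewrite c0 (lt_trans cb) // (lt_trans ba).
      have loc m x : 0 < u x - m%:R < 1 -> m == n x.
        rewrite subr_gt0 ltrBlDr nat1r => /andP[/ltW h1 h2].
        by apply/eqP/esym/truncn_def; rewrite h1.
      apply/and3P; split; apply: loc.
      - by rewrite -(lc1 i j k) all01 // !inE eqxx.
      - by rewrite -(lc2 i j k) all01 // !inE eqxx orbT.
      - by rewrite -(lc3 i j k) all01 // !inE eqxx !orbT.
    have [p2 p3 p4 [p5 p6]] := perm_eq3 e1 e2 e3.
    by rewrite !no.
  case/and3P: ijk => /eqP iE /eqP jE /eqP kE.
  have tr x : 0 <= u x - (n x)%:R <= 1.
    have /andP[h1 h2] := truncn_itv (u0 x).
    by rewrite subr_ge0 h1 lerBlDr nat1r ltW.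
  rewrite (one_order (f := local_coord (grid i j k))
     (P := fun a b c => hull (kuhn_simplex (grid i j k) a b c) q)) //.
  - by move=> a b c /perm_uniq abc; apply: kuhn_simplex_hull; rewrite abc.
  - move=> a b c /perm_uniq abc hq; have abc' : uniq [:: a; b; c] by rewrite abc.
    by have [] := S i j k iN jN kN a b c abc' hq.
  - by rewrite lc1 iE.
  - by rewrite lc2 jE.
  - by rewrite lc3 kE.
rewrite /box_sum.
under eq_bigr => i _ do under eq_bigr => j _ do under eq_bigr => k _ do rewrite cellE //.
rewrite (bigD1 (Ordinal (nN e1))) //= [X in _ (+) X]big1 ?addbF => [|i /negPf i1]; last first.
  by rewrite big1 // => j _; rewrite big1 // => k _; rewrite -val_eqE /= in i1; rewrite i1.
rewrite (bigD1 (Ordinal (nN e2))) //= [X in _ (+) X]big1 ?addbF => [|j /negPf j1]; last first.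
  by rewrite big1 // => k _; rewrite -val_eqE /= in j1; rewrite j1 andbF.
rewrite (bigD1 (Ordinal (nN e3))) //= [X in _ (+) X]big1 ?addbF => [|k /negPf k1]; last first.
  by rewrite -val_eqE /= in k1; rewrite k1 !andbF.
by rewrite !eqxx.
Qed.

End Cell.

(** * A heavily covered point *)

Section HalfSpaces.
Variables (R : realType) (d : nat).
Implicit Types (s : seq 'rV[R]_d) (z : 'rV[R]_d).

Lemma hull_le s z l m : (forall v, v \in s -> v 0 l <= m) -> hull s z -> z 0 l <= m.
Proof.
move=> sm [w [w0 w1 ->]]; rewrite summxE -[leRHS]mul1r -w1 mulr_suml.
by apply: ler_sum => i _; rewrite mxE ler_wpM2l // sm // mem_nth.
Qed.

Lemma hull_ge s z l m : (forall v, v \in s -> m <= v 0 l) -> hull s z -> m <= z 0 l.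
Proof.
move=> sm [w [w0 w1 ->]]; rewrite summxE -[leLHS]mul1r -w1 mulr_suml.
by apply: ler_sum => i _; rewrite mxE ler_wpM2l // sm // mem_nth.
Qed.

End HalfSpaces.

Lemma cnt1_mono (V : finType) (f g : V -> bool) :
  (forall a, f a -> g a) -> (cnt1 f <= cnt1 g)%N.
Proof. by move=> fg; apply: leq_sum => a _; case: (f a) (fg a) => // /(_ isT) ->. Qed.

Lemma cnt2_mono (V : finType) (f g : V -> V -> bool) :
  (forall a b, f a b -> g a b) -> (cnt2 f <= cnt2 g)%N.
Proof. by move=> fg; apply: leq_sum => a _; exact: (cnt1_mono (fg a)). Qed.

Lemma cnt3_mono (V : finType) (f g : V -> V -> V -> bool) :
  (forall a b c, f a b c -> g a b c) -> (cnt3 f <= cnt3 g)%N.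
Proof. by move=> fg; apply: leq_sum => a _; exact: (cnt2_mono (fg a)). Qed.

Section HeavyPoint.
Variables (R : realType) (V : finType) (p : V -> 'rV[R]_3).
Hypothesis p_inj : injective p.
Hypothesis gp : forall s : seq V, uniq s -> size s = 4%N ->
  forall (u : 'cV[R]_3) (b : R), u != 0 -> ~ (forall a, a \in s -> (p a *m u) 0 0 = b).
Hypothesis n_large : 15000%coqZ <= #|V|%:R :> Z.

Let V4 : (4 <= #|V|)%N.
Proof. by rewrite -(ler_nat Z); apply: le_trans n_large. Qed.

Let n_pos : 0 <= #|V|%:R :> Z. Proof. by []. Qed.

Definition close (e : R) (x y : 'rV[R]_3) : Prop := forall l, `|x 0 l - y 0 l| <= e.

Lemma close_hull e x s z :
  (forall v, v \in s -> close e x v) -> hull s z -> close e x z.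
Proof.
move=> xs sz l; rewrite ler_norml; apply/andP; split.
  have : z 0 l <= x 0 l + e.
    by apply: hull_le sz => v /xs/(_ l); rewrite ler_norml => /andP[]; lra.
  lra.
have : x 0 l - e <= z 0 l.
  by apply: hull_ge sz => v /xs/(_ l); rewrite ler_norml => /andP[]; lra.
lra.
Qed.

Section SmallScale.
Variables (e : R) (x y0 : 'rV[R]_3).
Hypothesis y0P : forall (abc : V * V * V) z, hull [:: p abc.1.1; p abc.1.2; p abc.2] z ->
  close e x z -> hull [:: p abc.1.1; p abc.1.2; p abc.2] y0.

(** A spanned triangle that meets the segment [x y] comes within [e] of [x], so it contains [y0];
    few triangles do. *)
Lemma cut1_small y : close e x x -> close e x y ->
  (cnt3 (cut1 p x y))%:R <= 7%coqZ * #|V|%:R ^+ 2 :> Z.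
Proof.
move=> xx xy; have : (cnt3 (cut1 p x y) <= 4 * #|V| ^ 2)%N.
  apply: leq_trans (cnt3_hull p_inj gp V4 y0); apply: cnt3_mono => a b c /asboolP[z [zx za]].
  apply/asboolP; apply: (y0P (abc := (a, b, c)) za); apply: close_hull zx => v.
  by rewrite !inE => /orP[] /eqP ->.
rewrite -(ler_nat Z) natrM natrX; move: n_pos; rewrite expr2; nia.
Qed.

Lemma cut2_small y z : close e x x -> close e x y -> close e x z ->
  (cnt2 (cut2 p x y z))%:R <= 3%coqZ * #|V|%:R :> Z.
Proof.
move=> xx xy xz; have : (cnt2 (cut2 p x y z) <= 3 * #|V|)%N.
  apply: leq_trans (cnt2_hull p_inj gp V4 y0); apply: cnt2_mono => a b /asboolP[t [tx ta]].
  (* A spanned segment is treated as a triangle with a repeated vertex. *)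
  have : hull [:: p a; p b; p b] y0.
    apply: (y0P (abc := (a, b, b)) (z := t)).
      by apply: hull_subset ta => v; rewrite !inE orbb.
    by apply: close_hull tx => v; rewrite !inE => /or3P[] /eqP ->.
  by move=> h; apply/asboolP; apply: hull_subset h => v; rewrite !inE orbb.
by rewrite -(ler_nat Z) natrM.
Qed.

Lemma cut3_small y z w : close e x x -> close e x y -> close e x z -> close e x w ->
  (cnt1 (cut3 p x y z w) <= 1)%N.
Proof.
move=> xx xy xz xw.
apply: leq_trans (cnt1_hull p_inj y0); apply: cnt1_mono => a /asboolP[t [tx ta]].
have : hull [:: p a; p a; p a] y0.
  apply: (y0P (abc := (a, a, a)) (z := t)).
    by apply: hull_subset ta => v; rewrite !inE !orbb.
  by apply: close_hull tx => v; rewrite !inE => /or4P[] /eqP ->.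
by move=> h; apply/asboolP; apply: hull_subset h => v; rewrite !inE !orbb.
Qed.

End SmallScale.

Lemma meet_outside (s : seq 'rV[R]_3) (t : seq V) l (m : R) :
  (forall v, v \in s -> v 0 l = m) ->
  (forall a, m < p a 0 l) \/ (forall a, p a 0 l < m) -> ~ meet s (map p t).
Proof.
move=> sm out [z [zs zt]].
have zm1 : z 0 l <= m by apply: hull_le zs => v /sm ->.
have zm2 : m <= z 0 l by apply: hull_ge zs => v /sm ->.
have t0 : (0 < size t)%N by case: (t) zt => // /hull_nil.
case: out => out.
  have [a0 a0t a0min] : exists2 a, a \in t & forall c, c \in t -> p a 0 l <= p c 0 l.
    have [a at0] : exists a, a \in t by case: (t) t0 => // a t' _; exists a; rewrite mem_head.
    by case: (@arg_minP _ _ _ a (mem t) (fun a => p a 0 l)) => // c ct h; exists c.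
  have : p a0 0 l <= z 0 l by apply: hull_ge zt => v /mapP[c ct ->]; apply: a0min.
  by have := out a0; lra.
have [a0 a0t a0max] : exists2 a, a \in t & forall c, c \in t -> p c 0 l <= p a 0 l.
  have [a at0] : exists a, a \in t by case: (t) t0 => // a t' _; exists a; rewrite mem_head.
  by case: (@arg_maxP _ _ _ a (mem t) (fun a => p a 0 l)) => // c ct h; exists c.
have : z 0 l <= p a0 0 l by apply: hull_le zt => v /mapP[c ct ->]; apply: a0max.
by have := out a0; lra.
Qed.

(** The first clause keeps [x] off all spanned triangles, so that only 4-tuples of distinct points
    count. *)
Lemma exists_heavy_point : exists x,
  (forall s : seq V, (size s <= 3)%N -> ~ hull (map p s) x) /\
  3%coqZ * #|V|%:R ^+ 4 < 40%coqZ * (cnt4 (cut0 p x))%:R.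
Proof.
apply: contrapT => nheavy.
have light x : (forall s : seq V, (size s <= 3)%N -> ~ hull (map p s) x) ->
    40%coqZ * (cnt4 (cut0 p x))%:R <= 3%coqZ * #|V|%:R ^+ 4.
  by move=> hx; rewrite leNgt; apply/negP => h; apply: nheavy; exists x.
pose B : R := 1 + \sum_a \sum_i `|p a 0 i|.
have B0 : 0 < B by rewrite ltr_pwDl // sumr_ge0 // => a _; apply: sumr_ge0.
have pB a i : `|p a 0 i| < B.
  rewrite /B (bigD1 a) //= (bigD1 i) //=.
  set u := `|_|; set s1 := \sum_(_ | _) _; set s2 := \sum_(_ | _) _.
  have s10 : 0 <= s1 by apply: sumr_ge0.
  have s20 : 0 <= s2 by apply: sumr_ge0 => ? _; apply: sumr_ge0.
  lra.
(* The lowest corner is [- B - 1] plus shifts in (0, 1], so this side still covers all points, and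
   grid coordinates stay within [B + 2] in absolute value. *)
pose L := 2 * B + 2.
have L0 : 0 < L by rewrite /L; lra.
have [e e0 eP] := @lebesgue_point R 3 (V * V * V)%type
  (fun abc => hull [:: p abc.1.1; p abc.1.2; p abc.2]) (B + 2) (fun _ => @hull_closed _ _ _).
pose N := (Num.truncn (L / e)).+1.
pose h := L / N%:R.
have N0 : 0 < N%:R :> R by rewrite ltr0n.
have h0 : 0 < h by rewrite divr_gt0.
have hN : h * N%:R = L by rewrite divfK // lt0r_neq0.
have he : h <= e.
  by rewrite ler_pdivrMr // mulrC -ler_pdivrMr // ltW // truncnS_gt.
pose base : 'rV[R]_3 := const_mx (- B - 1).
pose G := ('I_N.+1 * 'I_N.+1 * 'I_N.+1)%type.
pose g (ijk : G) := grid h base ijk.1.1 ijk.1.2 ijk.2.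
have [t [t0 t1 trD]] := transversal_shift p g.
set D := (D in transversal p D) in trD.
pose x0 := moment t + base.
pose c := grid h x0.
have cD i j k : (i <= N)%N -> (j <= N)%N -> (k <= N)%N -> D (c i j k).
  move=> iN jN kN; exists (inord i, inord j, inord k).
  by rewrite /g /= !inordK ?ltnS // /c /grid /x0 addrA.
have x0B l : - B - 1 < x0 0 l <= - B.
  rewrite !mxE; set s := t ^+ _.
  have s0 : 0 < s by rewrite exprn_gt0.
  have s1 : s <= 1 by rewrite exprn_ile1 // ltW.
  by apply/andP; split; lra.
have ord3 (l : 'I_3) : [\/ l = ord0, l = inord 1 | l = inord 2].
  by case: l => -[|[|[|//]]] hl; [constructor 1|constructor 2|constructor 3];
    apply/val_inj; rewrite //= inordK.
have c_coord i j k b1 b2 b3 : exists S : 'I_3 -> bool, forall l,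
    c (nat_of_bool b1 + i)%N (nat_of_bool b2 + j)%N (nat_of_bool b3 + k)%N 0 l =
    c i j k 0 l + h * (S l)%:R.
  exists (fun l => nth false [:: b1; b2; b3] l) => l.
  by case: (ord3 l) => ->; rewrite ?inordK //= /c ?grid_coord1 ?grid_coord2 ?grid_coord3 natrD;
    ring.
(* [S] tells in which directions [v] is one step away from the lowest corner of the cell. *)
pose cellv i j k (v : 'rV[R]_3) := exists S : 'I_3 -> bool, forall l,
  v 0 l = c i j k 0 l + h * (S l)%:R.
have cell_close i j k v v' : cellv i j k v -> cellv i j k v' -> close e v v'.
  move=> [S vS] [S' vS'] l; rewrite vS vS' ler_norml.
  move: (c i j k 0 l) he h0; clearbody h => r he' h0'; move: e0; clear -he' h0'.
  by case: (S l); case: (S' l); rewrite ?mulr1 ?mulr0 => e0'; apply/andP; split; lra.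
have cell_grid i j k v : (i < N)%N -> (j < N)%N -> (k < N)%N -> cellv i j k v ->
    exists i' j' k', [/\ (i' <= N)%N, (j' <= N)%N, (k' <= N)%N & v = c i' j' k'].
  move=> iN jN kN [S vS].
  exists (S ord0 + i)%N, (S (inord 1) + j)%N, (S (inord 2) + k)%N; split.
  - by case: (S _); rewrite ?add1n ?add0n // ltnW.
  - by case: (S _); rewrite ?add1n ?add0n // ltnW.
  - by case: (S _); rewrite ?add1n ?add0n // ltnW.
  apply/rowP => l; rewrite vS.
  case: (ord3 l) => ->; rewrite /c ?grid_coord1 ?grid_coord2 ?grid_coord3 natrD; ring.
have cellD i j k v : (i < N)%N -> (j < N)%N -> (k < N)%N -> cellv i j k v -> D v.
  move=> iN jN kN /(cell_grid _ _ _ _ iN jN kN)[i' [j' [k' [i'N j'N k'N ->]]]].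
  exact: cD.
have c_bound i j k l : (i <= N)%N -> (j <= N)%N -> (k <= N)%N ->
    x0 0 l <= c i j k 0 l <= x0 0 l + L.
  move=> iN jN kN; have bnd m : (m <= N)%N -> 0 <= h * m%:R <= L.
    by move=> mN; rewrite mulr_ge0 ?(ltW h0) //= -hN ler_wpM2l ?(ltW h0) // ler_nat.
  by case: (ord3 l) => ->; rewrite /c ?grid_coord1 ?grid_coord2 ?grid_coord3;
    rewrite lerDl lerD2l; [apply: (bnd i)|apply: (bnd j)|apply: (bnd k)].
(* By transversality a grid point lies on no spanned triangle, so the assumption that no point is
   heavy applies to it. *)
have Dlight x : D x -> 40%coqZ * (cnt4 (cut0 p x))%:R <= 3%coqZ * #|V|%:R ^+ 4.
  move=> Dx; apply: light => s s3 hs; apply: (trD [:: x] s).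
  - by move=> y; rewrite inE => /eqP ->.
  - by move: s3 => /=; lia.
  - exists x; split=> //; exists (fun _ => 1); split=> [//||].
      by rewrite big_ord_recl big_ord0 addr0.
    by rewrite big_ord_recl big_ord0 addr0 scale1r.
have [K [Ktet Kout]] := @assembly V 'rV[R]_3 D (cut0 p) (cut1 p) (cut2 p) (cut3 p) n_large
  (cut0_alt trD) (fun x y => @cut1_alt _ _ _ _ trD x y)
  (fun x Dx a b c d e => delta4_cut0 trD a b c d e Dx)
  (fun x y Dx Dy a b c d => delta3_cut1 trD a b c d Dx Dy)
  (fun x y z Dx Dy Dz a b c => delta2_cut2 trD a b c Dx Dy Dz)
  (fun x y z w Dx Dy Dz Dw a b => delta1_cut3 trD a b Dx Dy Dz Dw) Dlight.
have [a0 _] : exists a0 : V, true.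
  by have /card_gt0P[a _] : (0 < #|V|)%N := leq_trans (isT : 0 < 4)%N V4; exists a.
pose TK x y z w := K y z w a0 (+) K x z w a0 (+) K x y w a0 (+) K x y z a0.
pose TF x y z w := cut3 p x y z w a0.
(* [TF] tells whether [p a0] lies in the tetrahedron; transversality keeps [p a0] off the facets. *)
have sumF : box_sum N (cell_sum c TF) = true.
  have TFE x y z w : TF x y z w = `[< hull [:: x; y; z; w] (p a0) >].
    rewrite /TF; congr asbool; apply/propext; split=> [[q [qx [v [_]]]]|hq].
      by rewrite !big_ord_recl !big_ord0 /= !addr0 => -> qE; rewrite qE scale1r in qx.
    exists (p a0); split=> //; exists (fun _ => 1); split=> [//||].
      by rewrite big_ord_recl big_ord0 addr0.
    by rewrite big_ord_recl big_ord0 addr0 scale1r.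
  have -> : TF = fun x y z w => `[< hull [:: x; y; z; w] (p a0) >].
    by do 4 (apply/funext => ?); apply: TFE.
  apply: box_sum_containing => //.
    move=> i; have := pB a0 i; rewrite ltr_norml => /andP[h1 h2].
    have /andP[h3 h4] := x0B i; rewrite hN /L; apply/andP; split; lra.
  move=> i j k a b d m iN jN kN abd m4 hq.
  have kv v : v \in kuhn_simplex h (c i j k) a b d -> cellv i j k v.
    move: abd; rewrite /= !inE !negb_or andbT => /andP[/andP[ab ad] bd].
    case/or4P => /eqP ->.
    - by exists (fun _ => false) => l; rewrite mulr0 addr0.
    - by exists (fun l => l == a) => l; rewrite !mxE /=.
    - exists (fun l => (l == a) || (l == b)) => l; rewrite !mxE /=.
      by have [->|_] := eqVneq l a; rewrite ?(negPf ab) ?mulr0 ?addr0 ?mulr1.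
    - exists (fun l => [|| l == a, l == b | l == d]) => l; rewrite !mxE /=.
      have [->|_] := eqVneq l a; first by rewrite (negPf ab) (negPf ad) mulr0 !addr0 mulr1.
      by have [->|_] := eqVneq l b; rewrite ?(negPf bd) ?mulr0 ?addr0 ?mulr1.
  apply: (trD (facet m (kuhn_simplex h (c i j k) a b d)) [:: a0]).
  - move=> v /mapP[n]; rewrite mem_filter mem_iota => /andP[_ /= n4 ->].
    by apply: (cellD i j k) => //; apply: kv; rewrite mem_nth.
  - rewrite size_map size_filter /=.
    by case: m m4 {hq} => [|[|[|[|]]]].
  - exists (p a0); split=> //; exists (fun _ => 1); split=> [//||].
      by rewrite big_ord_recl big_ord0 addr0.
    by rewrite big_ord_recl big_ord0 addr0 scale1r.
have sumK : box_sum N (cell_sum c TK) = false.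
  (* An outer triangle lies in a coordinate plane beyond all points, so its cut cochains are zero
     and with them its filling. *)
  have face l m x y z : D x -> D y -> D z -> x 0 l = m -> y 0 l = m -> z 0 l = m ->
      m <= - B \/ B <= m -> K x y z a0 = false.
    move=> Dx Dy Dz xl yl zl mB.
    have out : (forall a, m < p a 0 l) \/ (forall a, p a 0 l < m).
      by case: mB => mB; [left|right] => a; have := pB a l; rewrite ltr_norml => /andP[]; lra.
    have no s (r : seq V) : (forall v, v \in s -> v = x \/ v = y \/ v = z) -> ~ meet s (map p r).
      move=> sxyz; apply: meet_outside out => v /sxyz.
      by case=> [->|[->|->]].
    apply: Kout => // [v vxyz a b c' d|a b c'|a b c'|a b c'|a b]; apply/asboolP.
    - apply: (no _ [:: a; b; c'; d]) => u; rewrite inE => /eqP ->; exact: vxyz.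
    - apply: (no _ [:: a; b; c']) => u; rewrite !inE => /orP[] /eqP ->; auto.
    - apply: (no _ [:: a; b; c']) => u; rewrite !inE => /orP[] /eqP ->; auto.
    - apply: (no _ [:: a; b; c']) => u; rewrite !inE => /orP[] /eqP ->; auto.
    - apply: (no _ [:: a; b]) => u; rewrite !inE => /or3P[] /eqP ->; auto.
  have edge l m : m = 0%N \/ m = N -> x0 0 l + h * m%:R <= - B \/ B <= x0 0 l + h * m%:R.
    have /andP[h3 h4] := x0B l; case=> ->; [left|right]; first by rewrite mulr0 addr0.
    by rewrite hN /L; lra.
  have le0N m : m = 0%N \/ m = N -> (m <= N)%N by case=> ->.
  apply: box_sum_faces => i j k iN jN kN; have kN' := le0N _ kN;
    have iN' := ltnW iN; have jN' := ltnW jN.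
  - by split; apply: (face (inord 2) (x0 0 (inord 2) + h * k%:R)); rewrite /c ?grid_coord3 //;
      first [exact: edge|exact: cD].
  - by split; apply: (face (inord 1) (x0 0 (inord 1) + h * j%:R)); rewrite /c ?grid_coord2 //;
      first [exact: edge|exact: cD].
  - by split; apply: (face ord0 (x0 0 ord0 + h * i%:R)); rewrite /c ?grid_coord1 //;
      first [exact: edge|exact: cD].
move: sumF; suff -> : box_sum N (cell_sum c TF) = box_sum N (cell_sum c TK) by rewrite sumK.
apply: eq_bigr => i _; apply: eq_bigr => j _; apply: eq_bigr => k _.
have tet x y z w : cellv i j k x -> cellv i j k y -> cellv i j k z -> cellv i j k w ->
    TF x y z w = TK x y z w.
  move=> cx cy cz cw.
  (* One common point per vertex of the cell: it serves every simplex starting at that vertex, as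
     the whole cell is within [e] of it. *)
  have small x' : cellv i j k x' -> exists y0, forall (abc : V * V * V) z',
      hull [:: p abc.1.1; p abc.1.2; p abc.2] z' -> close e x' z' ->
      hull [:: p abc.1.1; p abc.1.2; p abc.2] y0.
    move=> cx'; apply: eP => l.
    have [i' [j' [k' [i'N j'N k'N ->]]]] :=
      cell_grid _ _ _ _ (ltn_ord i) (ltn_ord j) (ltn_ord k) cx'.
    have /andP[h3 h4] := x0B l; have /andP[h5 h6] := c_bound i' j' k' l i'N j'N k'N.
    rewrite ler_norml; move: h6; rewrite /L => h6; apply/andP; split; lra.
  have [y1 y1P] := small x cx; have [y2 y2P] := small y cy; have [y3 y3P] := small z cz.
  have cc := cell_close i j k.
  have xD v : cellv i j k v -> D v by apply: cellD.
  apply/esym/Ktet; do ?exact: xD.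
  all: do ?[ exact: (cut1_small y1P (cc _ _ cx cx) (cc _ _ cx _))
           | exact: (cut1_small y2P (cc _ _ cy cy) (cc _ _ cy _))
           | exact: (cut1_small y3P (cc _ _ cz cz) (cc _ _ cz _))
           | exact: (cut2_small y1P (cc _ _ cx cx) (cc _ _ cx _) (cc _ _ cx _))
           | exact: (cut2_small y2P (cc _ _ cy cy) (cc _ _ cy _) (cc _ _ cy _)) ].
  exact: (cut3_small y1P (cc _ _ cx cx) (cc _ _ cx cy) (cc _ _ cx cz) (cc _ _ cx cw)).
have corner b1 b2 b3 : cellv i j k (c (nat_of_bool b1 + i)%N (nat_of_bool b2 + j)%N (nat_of_bool b3 + k)%N).
  exact: c_coord.
rewrite /cell_sum !tet //.
all: first [ exact: (corner false false false) | exact: (corner true false false)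
  | exact: (corner false true false) | exact: (corner false false true)
  | exact: (corner true true false) | exact: (corner true false true)
  | exact: (corner false true true) | exact: (corner true true true) ].
Qed.

End HeavyPoint.

(** * The selection constant *)

Local Open Scope fset_scope.
Local Open Scope ring_scope.

(** * From ordered 4-tuples to sets of four points *)

Section Translation.
Variables (R : realType) (P : {fset 'rV[R]_3}).

Let p (a : P) : 'rV[R]_3 := val a.

Lemma general_position_uniq : general_position P ->
  forall s : seq P, uniq s -> size s = 4%N ->
  forall (u : 'cV[R]_3) (b : R), u != 0 -> ~ (forall a, a \in s -> (p a *m u) 0 0 = b).
Proof.
move=> gP s us s4 u b u0 sb; pose S := [fset q in map p s].
apply: (gP S).
- by apply/fsubsetP => q; rewrite inE => /mapP[a _ ->]; apply: valP.
- rewrite card_fseq undup_id ?size_map //.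
  by rewrite map_inj_uniq //; apply: val_inj.
- by exists u, b; split=> // q; rewrite inE => /mapP[a /sb + ->].
Qed.

Lemma convex_hull_fset (s : seq 'rV[R]_3) x : uniq s -> hull s x ->
  convex_hull [fset q in s] x.
Proof.
move=> us [w [w0 w1 xE]].
have ps : perm_eq [fset q in s] s.
  by apply: uniq_perm => // q; rewrite inE.
exists (fun q => w (index q s)); split=> [q _||]; first exact: w0.
  rewrite (perm_big _ ps) /= (big_nth 0) big_mkord -w1.
  by apply: eq_bigr => i _; rewrite index_uniq.
rewrite (perm_big _ ps) /= (big_nth 0) big_mkord xE.
by apply: eq_bigr => i _; rewrite index_uniq.
Qed.

Lemma cnt4_tuple (V : finType) (f : V -> V -> V -> V -> bool) : cnt4 f =
  #|[set t : 4.-tuple V | f (tnth t 0) (tnth t 1) (tnth t 2) (tnth t 3)]|.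
Proof.
rewrite -sum1_card /cnt4 !pair_bigA /= [RHS]big_mkcond /=.
pose g (q : V * V * V * V) : 4.-tuple V := [tuple q.1.1.1; q.1.1.2; q.1.2; q.2].
rewrite [RHS](reindex g) /=.
  by apply: eq_bigr => -[[[a b] c] d] _; rewrite inE; case: (f _ _ _ _).
apply: onW_bij; exists (fun t => (tnth t 0, tnth t 1, tnth t 2, tnth t 3)).
  by move=> [[[a b] c] d].
by move=> t; apply: eq_from_tnth => -[[|[|[|[|//]]]] i4]; rewrite (tnth_nth (tnth t 0)) /=;
  congr tnth; apply: val_inj.
Qed.

(** A tuple with a repeated entry spans at most three points, so its hull misses [x]; a set of four
    points has 4! orderings. *)
Lemma cnt4_simplices x : (forall s : seq P, (size s <= 3)%N -> ~ hull (map p s) x) ->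
  (cnt4 (cut0 p x) <= 24 * #|` simplices_containing P x|)%N.
Proof.
move=> small; rewrite cnt4_tuple.
set T := [set t | _]; set S := simplices_containing P x.
have TP (t : 4.-tuple P) : t \in T -> hull (map p t) x /\ uniq t.
  rewrite inE => /asboolP[z [[w [_]]]].
  rewrite !big_ord_recl !big_ord0 /= !addr0 => -> ->; rewrite scale1r => h.
  have {}h : hull (map p t) x.
    apply: hull_subset h => v; rewrite !inE => /or4P[] /eqP ->; apply: map_f; exact: mem_tnth.
  split=> //; apply: contraT => nu; exfalso; apply: (small (undup t)).
    by rewrite -ltnS -[X in (_ < X)%N](size_tuple t) ltn_size_undup.
  by apply: hull_subset h => v /mapP[a ta ->]; apply: map_f; rewrite mem_undup.
pose f (t : 4.-tuple P) := [fset q in map p t].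
have fS t : t \in T -> f t \in S.
  move=> /TP[h us]; have um : uniq (map p t) by rewrite map_inj_uniq //; apply: val_inj.
  rewrite !inE /= fpowersetE; apply/andP; split.
    by apply/fsubsetP => q; rewrite inE => /mapP[a _ ->]; apply: valP.
  rewrite card_fseq undup_id // size_map size_tuple eqxx /=.
  by apply/asboolP; apply: convex_hull_fset.
have fib A : A \in S -> (#|[set t in T | f t == A]| <= 24)%N.
  move=> AS; pose B := [pred a : P | p a \in A].
  have cB : (#|B| <= 4)%N.
    have /eqP <- : #|` A| == 4%N by move: AS; rewrite !inE => /and3P[].
    rewrite cardE -(size_map p); apply: uniq_leq_size.
      by rewrite map_inj_uniq ?enum_uniq //; apply: val_inj.
    by move=> q /mapP[a]; rewrite mem_enum inE => aA ->.
  apply: (@leq_trans #|[set t : 4.-tuple P | all B t & uniq t]|).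
    apply: subset_leq_card; apply/fintype.subsetP => t; rewrite inE => /andP[tT /eqP ft].
    rewrite inE (TP t tT).2 andbT; apply/allP => a ta.
    by rewrite inE -ft inE; apply: map_f.
  by rewrite card_uniq_tuples; case: #|B| cB => [|[|[|[|[|]]]]].
have -> : (24 * #|` S| = \sum_(A <- S) 24)%N.
  by rewrite big_const_seq count_predT iter_addn_0.
rewrite -sum1_card.
apply: (@leq_trans (\sum_(t in T) \sum_(A <- S) (f t == A))%N).
  apply: leq_sum => t tT; rewrite (bigD1_seq (f t)) /= ?fset_uniq ?fS // eqxx.
  exact: leq_addr.
rewrite exchange_big /= big_seq [leqRHS]big_seq; apply: leq_sum => A AS.
apply: leq_trans (fib A AS); rewrite -sum1_card.
rewrite [leqRHS]big_mkcond [leqLHS]big_mkcond; apply: leq_sum => t _.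
have -> : (t \in [set t in T | f t == A]) = (t \in T) && (f t == A).
  by rewrite finset.in_set.
by case: (t \in T); case: (f t == A).
Qed.


End Translation.

Lemma bin4_le (n : nat) : (24 * 'C(n, 4) <= n ^ 4)%N.
Proof.
rewrite mulnC -[24%N]/(4`!) bin_ffact.
have le a b : (a - b <= a)%N by apply: leq_subr.
rewrite 4!ffactnS ffactn0 muln1 !expnS expn0 muln1.
by rewrite !leq_mul // -?subn1 ?leq_subr // ?(leq_trans (leq_subr _ _)) ?leq_subr.
Qed.

Lemma bin4_ge (n : nat) : (n ^ 4 <= 24 * 'C(n + 3, 4))%N.
Proof.
rewrite mulnC -[24%N]/(4`!) bin_ffact.
rewrite !addnS addn0 !ffactSS ffactn1 !expnS expn0 muln1.
rewrite !leq_mul //; lia.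
Qed.

(** Sets with fewer than [n0] points are absorbed by the O-term, as C(n,4) <= n^4 <= n0 n^3. For the
    others the heavy point lies in more than 3 n^4 / 40 ordered tuples, and n^4 >= 24 C(n,4). *)
Lemma selection_ratio_3_40 (R : realType) : selection_ratio 3 (3%:R / 40%:R : R).
Proof.
have [n0 n0P] : exists n0 : nat, forall n : nat, (n0 <= n)%N -> 15000%coqZ <= n%:R.
  by exists (Z.to_nat 15000%coqZ) => n; lia.
exists n0%:R => P gP; set n := #|` P|.
have Vn : #|{: P}| = n by rewrite /n cardfE.
have [nlarge|nsmall] := leqP n0 n; last first.
  exists 0; apply: (@le_trans _ _ 0); last exact: ler0n.
  rewrite subr_le0; apply: (@le_trans _ _ ('C(n, 4)%:R)).
    by rewrite ler_piMl // ler_pdivrMr ?ltr0n // mul1r ler_nat.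
  rewrite -natrX -natrM ler_nat.
  have := bin4_le n; rewrite expnS => h.
  have := leq_mul (ltnW nsmall) (leqnn (n ^ 3)); lia.
have [x [small heavy]] := exists_heavy_point (p := fun a : P => val a) val_inj
  (general_position_uniq gP) (eq_ind_r (fun m => 15000%coqZ <= m%:R) (n0P _ nlarge) Vn).
exists x.
have le := cnt4_simplices small; set m := #|` _| in le *.
have h : (3 * 'C(n, 4) <= 40 * m)%N.
  move: heavy le; rewrite Vn; move: (cnt4 _) => k heavy le.
  have {}heavy : (3 * n ^ 4 < 40 * k)%N.
    by rewrite -(ltr_nat Z) [(3 * _)%N%:R]natrM natrX [(40 * _)%N%:R]natrM.
  have := bin4_le n; lia.
have nn0 : 0 <= (n0%:R * n%:R ^+ 3 : R) by rewrite mulr_ge0 // exprn_ge0.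
rewrite lerBlDr; apply: le_trans (_ : m%:R <= _); last by rewrite lerDl.
by rewrite mulrAC ler_pdivrMr ?ltr0n // -!natrM ler_nat mulnC [(m * _)%N]mulnC [('C(_, _) * _)%N]mulnC.
Qed.

(** * Boundedness of the admissible ratios *)

Lemma simplices_le_bin (R : realType) (P : {fset 'rV[R]_3}) x :
  (#|` simplices_containing P x| <= 'C(#|` P|, 4))%N.
Proof.
rewrite [X in 'C(X, _)]cardfE -card_draws.
pose g (A : {fset 'rV[R]_3}) := [set a : P | val a \in A].
have gA A : A \in simplices_containing P x -> [fset val a | a in g A] = A.
  rewrite !inE fpowersetE => /andP[/fsubsetP AP _]; apply/fsetP => q.
  apply/imfsetP/idP => [[a]|qA]; first by rewrite inE => aA ->.
  by exists [` AP q qA]; rewrite ?inE.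
rewrite cardE -(size_map g); apply: uniq_leq_size.
  rewrite map_inj_in_uniq ?fset_uniq // => A B /gA {2}<- /gA {2}<- -> //.
move=> _ /mapP[A AS ->]; rewrite mem_enum inE.
have := gA A AS; move: AS; rewrite !inE => /and3P[_ /eqP A4 _] /(congr1 (fun B => #|` B|)).
rewrite A4 card_imfset //= ?val_inj; last exact: val_inj.
by rewrite -cardE => ->.
Qed.

(** A plane meets the moment curve in at most three points, the roots of a polynomial of degree at
    most 3. *)
Lemma exists_general_position (R : realType) (n : nat) :
  exists P : {fset 'rV[R]_3}, general_position P /\ #|` P| = n.
Proof.
pose s := [seq moment (i%:R : R) | i <- iota 0 n].
have mI : injective (@moment R).
  by move=> a b /rowP/(_ 0); rewrite !mxE !expr1.
have us : uniq s.
  rewrite map_inj_uniq ?iota_uniq // => i j /mI /eqP.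
  by rewrite eqr_nat => /eqP.
exists [fset q in s]; split; last by rewrite card_fseq undup_id // size_map size_iota.
move=> S /fsubsetP Ss S4 [u [b [u0 ub]]].
have q0 := moment_poly_neq0 b u0.
pose r := [seq (q : 'rV[R]_3) 0 0 | q <- S].
have onS (q : 'rV[R]_3) : q \in S -> q = moment (q 0 0).
  by move=> /Ss; rewrite inE => /mapP[i _ ->]; rewrite mxE expr1.
have ur : uniq r.
  by rewrite map_inj_in_uniq ?fset_uniq // => a c /onS {2}-> /onS {2}-> ->.
have : (size r < size (moment_poly u b))%N.
  apply: max_poly_roots => //; apply/allP => _ /mapP[q qS ->].
  by rewrite /root moment_polyE -onS // ub // subrr.
by rewrite size_map S4 ltnNge size_poly.
Qed.

(** For large sets in general position a leading coefficient above 1 would ask for more than all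
    C(n,4) simplices. *)
Lemma selection_ratio_le1 (R : realType) (c : R) : selection_ratio 3 c -> c <= 1.
Proof.
move=> [K hK]; rewrite leNgt; apply/negP => c1.
have c10 : 0 < c - 1 by rewrite subr_gt0.
(* 1536 is 24 times 64, from C(m + 3, 4) >= m^4 / 24 and (m + 3)^3 <= 64 m^3. *)
pose m := (Num.truncn (`|K| * 1536%:R / (c - 1))).+1.
have [P [gP Pn]] := exists_general_position R (m + 3).
have [x] := hK P gP; rewrite Pn leNgt => /negP; apply.
have := simplices_le_bin P x; rewrite Pn -(ler_nat R) => h.
apply: le_lt_trans h _; rewrite -subr_gt0.
have m0 : 0 < m%:R :> R by rewrite ltr0n.
have mK : `|K| * 1536%:R < m%:R * (c - 1) by rewrite -ltr_pdivrMr // truncnS_gt.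
have n4m : (m + 3)%:R <= 4%:R * m%:R :> R by rewrite -natrM ler_nat /m; lia.
have bin : m%:R ^+ 4 <= 24%:R * 'C(m + 3, 4)%:R :> R.
  by rewrite -natrX -natrM ler_nat bin4_ge.
have n3 : (m + 3)%:R ^+ 3 <= 64%:R * m%:R ^+ 3 :> R.
  have -> : 64%:R * m%:R ^+ 3 = (4%:R * m%:R) ^+ 3 :> R by ring.
  by apply: lerXn2r => //; rewrite nnegrE ?ler0n // mulr_ge0.
have Kn : K * (m + 3)%:R ^+ 3 <= `|K| * (64%:R * m%:R ^+ 3).
  apply: (@le_trans _ _ (`|K| * (m + 3)%:R ^+ 3)); last by rewrite ler_wpM2l.
  by rewrite ler_wpM2r ?ler_norm // exprn_ge0.
have h1 := ler_wpM2r (ltW c10) bin.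
have m3 : 0 < m%:R ^+ 3 :> R by rewrite exprn_gt0.
have h2 := ltr_pM2r m3 (`|K| * 1536%:R) (m%:R * (c - 1)); rewrite mK in h2.
move: h1 h2 Kn; rewrite !exprS expr0 mulr1.
set M := m%:R; set C := 'C(_, _)%:R; lra.
Qed.

Theorem mainTheorem2 (R : realType) :
  748 / 10 ^+ 4 < selection_constant R 3.
Proof.
apply: (@lt_le_trans _ _ (3%:R / 40%:R)); first by lra.
(* Boundedness by 1 makes the supremum an upper bound of the set. *)
apply: ub_le_sup; last exact: selection_ratio_3_40.
by exists 1 => c /selection_ratio_le1.
Qed.
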